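(* Let $\mathcal{A}$ be a weakly finite Hopf algebra (e.g. $\mathcal{A}$ left or right noetherian) with invertible antipode over a field and let $P\in\mathcal{A}$ be a right group-like projection. Then $\mathcal{N}_P=\mathcal{V}_P$.
   Context: $(\mathcal{A},\Delta,S,\varepsilon)$ is a Hopf algebra over an arbitrary field with invertible antipode $S$ and unit $1$. An algebra $R$ is weakly finite if for all positive integers $n$ and all $x,y\in M_n(R)$, $xy=1$ implies $yx=1$. A projection is an idempotent. A right group-like projection is a non-zero projection $P\in\mathcal{A}$ with $\Delta(P)(1\otimes P)=P\otimes P=(1\otimes P)\Delta(P)$. Define $\mathcal{N}_P=\{x\in\mathcal{A}:\Delta(x)(1\otimes P)=(1\otimes P)\Delta(x)=x\otimes P\}$ and $\mathcal{V}_P=\{(\mu\otimes\mathrm{id})(\Delta(P)):\mu\in\mathcal{A}^*\}$. *)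

(* Defs.v *)
From HB Require Import structures.
From mathcomp Require Import all_boot all_order all_algebra.
From mathcomp Require Import boolp classical_sets.

Set Implicit Arguments.
Unset Strict Implicit.
Unset Printing Implicit Defensive.

Import GRing.Theory.
Local Open Scope ring_scope.
Local Open Scope quotient_scope.

Reserved Notation "u \ox v" (at level 40, left associativity).

(* Tensor products of modules over a commutative ring K. A formal sum
   [:: (u1, v1); ...; (un, vn)] stands for u1 (x) v1 + ... + un (x) vn;
   [tens_cong] is the least congruence (for concatenation) imposing
   commutativity, biadditivity and K-balancedness. *)
Section TensorDef.
Variables (K : comNzRingType) (U V : lmodType K).

Inductive tens_cong : seq (U * V) -> seq (U * V) -> Prop :=
| tens_cong_refl s : tens_cong s s
| tens_cong_sym s t : tens_cong s t -> tens_cong t s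
| tens_cong_trans s t r : tens_cong s t -> tens_cong t r -> tens_cong s r
| tens_cong_cat s s' t t' :
    tens_cong s s' -> tens_cong t t' -> tens_cong (s ++ t) (s' ++ t')
| tens_cong_catC s t : tens_cong (s ++ t) (t ++ s)
| tens_cong_addl u u' v :
    tens_cong [:: (u + u', v)] [:: (u, v); (u', v)]
| tens_cong_addr u v v' :
    tens_cong [:: (u, v + v')] [:: (u, v); (u, v')]
| tens_cong_scale k u v : tens_cong [:: (k *: u, v)] [:: (u, k *: v)]
| tens_cong_zero v : tens_cong [:: (0, v)] [::].

Definition tens_congb : rel (seq (U * V)) := fun s t => `[< tens_cong s t >].

Lemma tens_congb_equiv : equiv_class_of tens_congb.
Proof.
split=> [s|s t|s t r].
- exact/asboolP/tens_cong_refl.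
- by apply/asboolP/asboolP; apply: tens_cong_sym.
- by move=> /asboolP st /asboolP sr; apply/asboolP/(tens_cong_trans st sr).
Qed.

Canonical tens_cong_equiv := EquivRelPack tens_congb_equiv.

Definition tensor := {eq_quot tens_congb}.

HB.instance Definition _ : EqQuotient _ tens_congb tensor :=
  EqQuotient.on tensor.
HB.instance Definition _ := Choice.on tensor.

Lemma tens_piP s t : reflect (tens_cong s t) (s == t %[mod tensor]).
Proof. by rewrite piE; apply/asboolP. Qed.

Lemma tens_pi s t : tens_cong s t -> \pi_tensor s = \pi_tensor t.
Proof. by move=> st; apply/eqP/tens_piP. Qed.

Lemma tens_repr s : tens_cong (repr (\pi_tensor s)) s.
Proof. by apply/tens_piP; rewrite reprK. Qed.

Lemma tens_quotW (Q : tensor -> Prop) :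
  (forall s, Q (\pi_tensor s)) -> forall x, Q x.
Proof. by move=> Qpi x; rewrite -[x]reprK. Qed.

Definition tens (u : U) (v : V) : tensor := \pi_tensor [:: (u, v)].

Let zero : tensor := \pi_tensor [::].
Let add (x y : tensor) : tensor := \pi_tensor (repr x ++ repr y).
Let opp (x : tensor) : tensor :=
  \pi_tensor [seq (- p.1, p.2) | p <- repr x].
Let scale (k : K) (x : tensor) : tensor :=
  \pi_tensor [seq (k *: p.1, p.2) | p <- repr x].

Lemma tens_cong_map (h : {linear U -> U}) s t : tens_cong s t ->
  tens_cong [seq (h p.1, p.2) | p <- s] [seq (h p.1, p.2) | p <- t].
Proof.
elim=> {s t} /= [s|s t _|s t r _ st _|s s' t t' _ ss' _ tt'|s t|u u' v|u v v'
  |k u v|v].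
- exact: tens_cong_refl.
- exact: tens_cong_sym.
- exact: tens_cong_trans st.
- by rewrite !map_cat; apply: tens_cong_cat.
- by rewrite !map_cat; apply: tens_cong_catC.
- by rewrite linearD; apply: tens_cong_addl.
- exact: tens_cong_addr.
- by rewrite linearZ; apply: tens_cong_scale.
- by rewrite linear0; apply: tens_cong_zero.
Qed.

Let addE s t : add (\pi_tensor s) (\pi_tensor t) = \pi_tensor (s ++ t).
Proof. by apply: tens_pi; apply: tens_cong_cat; apply: tens_repr. Qed.

Let oppE s : opp (\pi_tensor s) = \pi_tensor [seq (- p.1, p.2) | p <- s].
Proof. by apply: tens_pi; apply: (tens_cong_map -%R); apply: tens_repr. Qed.

Let scaleE k s :
  scale k (\pi_tensor s) = \pi_tensor [seq (k *: p.1, p.2) | p <- s].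
Proof. by apply: tens_pi; apply: (tens_cong_map ( *:%R k)); apply: tens_repr. Qed.

Let addA : associative add.
Proof.
move=> x y z; elim/tens_quotW: x => s; elim/tens_quotW: y => t; elim/tens_quotW: z => r.
by rewrite !addE catA.
Qed.

Let addC : commutative add.
Proof.
move=> x y; elim/tens_quotW: x => s; elim/tens_quotW: y => t; rewrite !addE.
exact/tens_pi/tens_cong_catC.
Qed.

Let add0 : left_id zero add.
Proof. by move=> x; elim/tens_quotW: x => s; rewrite addE. Qed.

Let addN : left_inverse zero opp add.
Proof.
have addACA a b c d : add (add a b) (add c d) = add (add a c) (add b d).
  by rewrite !addA -!(addA a) (addC b).
have tensN u v : add (\pi_tensor [:: (- u, v)]) (\pi_tensor [:: (u, v)]) = zero.
  rewrite addE; apply: tens_pi; apply: tens_cong_trans (tens_cong_zero v).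
  by apply: tens_cong_sym; rewrite -(addNr u); apply: tens_cong_addl.
move=> x; elim/tens_quotW: x => s; rewrite oppE.
elim: s => [|[u v] s IH] /=; first by rewrite addE.
by rewrite -cat1s -[(u, v) :: s]cat1s -!addE addACA tensN IH add0.
Qed.

HB.instance Definition _ := GRing.isZmodule.Build tensor addA addC add0 addN.

Lemma tens_pi_cat s t : \pi_tensor (s ++ t) = \pi_tensor s + \pi_tensor t.
Proof. by rewrite -addE. Qed.

Lemma tens_pi_sum s : \pi_tensor s = \sum_(p <- s) tens p.1 p.2.
Proof.
elim: s => [|[u v] s IH]; first by rewrite big_nil.
by rewrite big_cons -cat1s tens_pi_cat IH.
Qed.

Lemma tensorE (x : tensor) : {s | x = \sum_(p <- s) tens p.1 p.2}.
Proof. by exists (repr x); rewrite -tens_pi_sum reprK. Qed.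

Lemma tensor_ind (Q : tensor -> Prop) :
    Q 0 -> (forall u v x, Q x -> Q (tens u v + x)) -> forall x, Q x.
Proof.
move=> Q0 QD x; have [s ->] := tensorE x.
by elim: s => [|p s IH]; rewrite ?big_nil// big_cons; apply: QD.
Qed.

Let scaleA a b v : scale a (scale b v) = scale (a * b) v.
Proof.
elim/tens_quotW: v => s; rewrite !scaleE -map_comp; congr (\pi_tensor _).
by apply: eq_map => p /=; rewrite scalerA.
Qed.

Let scale1 : left_id 1 scale.
Proof.
move=> x; elim/tens_quotW: x => s; rewrite scaleE; congr (\pi_tensor _).
by rewrite -[RHS]map_id; apply: eq_map => -[u v] /=; rewrite scale1r.
Qed.

Let scaleDr : right_distributive scale +%R.
Proof.
move=> k x y; elim/tens_quotW: x => s; elim/tens_quotW: y => t.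
by rewrite -tens_pi_cat !scaleE map_cat tens_pi_cat.
Qed.

Let scaleDl v : {morph scale^~ v : a b / a + b}.
Proof.
move=> a b; elim/tens_quotW: v => s; rewrite !scaleE.
elim: s => [|[u v] s IH] /=; first by rewrite -tens_pi_cat.
rewrite -cat1s tens_pi_cat IH -[_ :: map _ s]cat1s tens_pi_cat.
rewrite -[_ :: [seq (b *: _, _) | _ <- _]]cat1s tens_pi_cat.
rewrite addrACA; congr (_ + _).
by rewrite scalerDl -tens_pi_cat; apply/tens_pi/tens_cong_addl.
Qed.

HB.instance Definition _ :=
  GRing.Zmodule_isLmodule.Build K tensor scaleA scale1 scaleDr scaleDl.

Lemma tens_is_bilinear : bilinear_for *:%R *:%R tens.
Proof.
have scaleEt k u v : k *: tens u v = tens (k *: u) v by rewrite [LHS]scaleE.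
split=> [v k u u'|u k v v'] /=; rewrite scaleEt -tens_pi_cat.
  exact/tens_pi/tens_cong_addl.
apply: tens_pi; apply: tens_cong_trans (tens_cong_addr _ _ _) _.
apply: (@tens_cong_cat [:: _] _ [:: _]); last exact: tens_cong_refl.
exact/tens_cong_sym/tens_cong_scale.
Qed.

HB.instance Definition _ :=
  bilinear_isBilinear.Build K U V tensor *:%R *:%R tens tens_is_bilinear.

Variable W : lmodType K.

(* Universal property. [lift f] is meaningful for bilinear f only; it is then
   the unique linear map sending u (x) v to f u v. *)
Definition lift (f : U -> V -> W) (x : tensor) : W :=
  \sum_(p <- repr x) f p.1 p.2.

Section Lift.
Variable f : {bilinear U -> V -> W}.

Lemma lift_pi s : lift f (\pi_tensor s) = \sum_(p <- s) f p.1 p.2.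
Proof.
rewrite /lift; have := tens_repr s; move: (repr _) => t.
elim=> {s t} /= [s|s t _ ->|s t r _ -> _ ->|s s' t t' _ ss' _ tt'|s t
  |u u' v|u v v'|k u v|v] //.
- by rewrite !big_cat /= ss' tt'.
- by rewrite !big_cat /= addrC.
- by rewrite !big_cons !big_nil /= linearDl !addr0.
- by rewrite !big_cons !big_nil /= linearDr !addr0.
- by rewrite !big_seq1 /= linearZl_LR linearZr_LR.
- by rewrite big_seq1 big_nil /= linear0l.
Qed.

Lemma lift_is_linear : linear (lift f).
Proof.
move=> k x y; elim/tens_quotW: x => s; elim/tens_quotW: y => t.
have -> : k *: \pi_tensor s = \pi_tensor [seq (k *: p.1, p.2) | p <- s].
  exact: scaleE.
rewrite -tens_pi_cat !lift_pi big_cat /= big_map scaler_sumr.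
by congr (_ + _); apply: eq_bigr => p _ /=; rewrite linearZl_LR.
Qed.

HB.instance Definition _ :=
  GRing.isLinear.Build K tensor W *:%R (lift f) lift_is_linear.

Lemma lift_tens u v : lift f (tens u v) = f u v.
Proof. by rewrite lift_pi big_seq1. Qed.

End Lift.

Lemma tensor_ext (f g : {linear tensor -> W}) :
  (forall u v, f (tens u v) = g (tens u v)) -> f =1 g.
Proof.
move=> fg; elim/tensor_ind=> [|u v x IH]; first by rewrite !linear0.
by rewrite !linearD IH fg.
Qed.

End TensorDef.

Notation "u \ox v" := (tens u v) : ring_scope.

Section TensorMap.
Variables (K : comNzRingType) (U U' V V' : lmodType K).
Variables (f : {linear U -> U'}) (g : {linear V -> V'}).

Definition tens_map_fun (u : U) (v : V) : tensor U' V' := f u \ox g v.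

Lemma tens_map_fun_is_bilinear : bilinear_for *:%R *:%R tens_map_fun.
Proof.
split=> [v k u u'|u k v v']; rewrite /tens_map_fun linearP.
- by rewrite linearDl linearZl_LR.
- by rewrite linearDr linearZr_LR.
Qed.

HB.instance Definition _ :=
  bilinear_isBilinear.Build K U V (tensor U' V') *:%R *:%R tens_map_fun
    tens_map_fun_is_bilinear.

Definition tens_map : {linear tensor U V -> tensor U' V'} := lift tens_map_fun.

Lemma tens_mapE u v : tens_map (u \ox v) = f u \ox g v.
Proof. exact: lift_tens. Qed.

End TensorMap.

Section TensorUnit.
Variables (K : comNzRingType) (V : lmodType K).

Definition scale_fun (k : K^o) (v : V) : V := k *: v.

Lemma scale_fun_is_bilinear : bilinear_for *:%R *:%R scale_fun.
Proof.
split=> [v k a b|a k u v]; rewrite /scale_fun.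
- by rewrite /= scalerDl scalerA.
- by rewrite /= scalerDr !scalerA mulrC.
Qed.

HB.instance Definition _ :=
  bilinear_isBilinear.Build K K^o V V *:%R *:%R scale_fun
    scale_fun_is_bilinear.

Definition scale_funr (v : V) (k : K^o) : V := k *: v.

Lemma scale_funr_is_bilinear : bilinear_for *:%R *:%R scale_funr.
Proof.
split=> [k|v]; first exact: scale_fun_is_bilinear.2.
exact: scale_fun_is_bilinear.1.
Qed.

HB.instance Definition _ :=
  bilinear_isBilinear.Build K V K^o V *:%R *:%R scale_funr
    scale_funr_is_bilinear.

(* The canonical isomorphisms K (x) V = V and V (x) K = V. *)
Definition tens_lunit : {linear tensor K^o V -> V} := lift scale_fun.
Definition tens_runit : {linear tensor V K^o -> V} := lift scale_funr.

Lemma tens_lunitE (k : K^o) v : tens_lunit (k \ox v) = k *: v.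
Proof. exact: lift_tens. Qed.

Lemma tens_runitE v (k : K^o) : tens_runit (v \ox k) = k *: v.
Proof. exact: lift_tens. Qed.

End TensorUnit.

Arguments tens_lunit {K V}.
Arguments tens_runit {K V}.

Section TensorAssoc.
Variables (K : comNzRingType) (U V W : lmodType K).

Definition assoc_fun2 (w : W) (u : U) (v : V) : tensor U (tensor V W) :=
  u \ox (v \ox w).

Lemma assoc_fun2_is_bilinear w : bilinear_for *:%R *:%R (assoc_fun2 w).
Proof.
split=> [v k a b|a k u v]; rewrite /assoc_fun2.
- by rewrite linearDl linearZl_LR.
- by rewrite linearDl linearZl_LR linearDr linearZr_LR.
Qed.

HB.instance Definition _ w :=
  bilinear_isBilinear.Build K U V (tensor U (tensor V W)) *:%R *:%R
    (assoc_fun2 w) (assoc_fun2_is_bilinear w).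

Definition assoc_fun (x : tensor U V) (w : W) : tensor U (tensor V W) :=
  lift (assoc_fun2 w) x.

Lemma assoc_fun_is_bilinear : bilinear_for *:%R *:%R assoc_fun.
Proof.
split=> [w k x y|x k w w']; rewrite /assoc_fun /=; first by rewrite linearP.
elim/tensor_ind: x => [|u v x IH]; first by rewrite !linear0 ?scaler0 addr0.
rewrite !linearD /= {}IH !lift_tens ?scalerDr addrACA; congr (_ + _).
by rewrite /= /assoc_fun2 linearDr linearZr_LR linearDr linearZr_LR.
Qed.

HB.instance Definition _ :=
  bilinear_isBilinear.Build K (tensor U V) W (tensor U (tensor V W)) *:%R *:%R
    assoc_fun assoc_fun_is_bilinear.

Definition tens_assoc :
  {linear tensor (tensor U V) W -> tensor U (tensor V W)} := lift assoc_fun.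

Lemma tens_assocE u v w : tens_assoc (u \ox v \ox w) = u \ox (v \ox w).
Proof. rewrite [LHS]lift_tens; exact: lift_tens. Qed.

End TensorAssoc.

Arguments tens_assoc {K U V W}.

(* A (x) B is registered as a ring and as a module, but not as an algType:
   the library's algebras are nontrivial rings, and over a mere commutative
   ring K the tensor product of two nontrivial algebras may be trivial. *)
Section TensorAlgebra.
Variables (K : comNzRingType) (A B : algType K).

Definition tens_mul2 (a : A) (b : B) (a' : A) (b' : B) : tensor A B :=
  (a * a') \ox (b * b').

Lemma tens_mul2_is_bilinear a b : bilinear_for *:%R *:%R (tens_mul2 a b).
Proof.
split=> [v k u u'|u k v v']; rewrite /tens_mul2.
- by rewrite /= mulrDr -scalerAr linearDl linearZl_LR.
- by rewrite /= mulrDr -scalerAr linearDr linearZr_LR.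
Qed.

HB.instance Definition _ a b :=
  bilinear_isBilinear.Build K A B (tensor A B) *:%R *:%R
    (tens_mul2 a b) (tens_mul2_is_bilinear a b).

Definition tens_mul1 (y : tensor A B) (a : A) (b : B) : tensor A B :=
  lift (tens_mul2 a b) y.

Lemma tens_mul1_is_bilinear y : bilinear_for *:%R *:%R (tens_mul1 y).
Proof.
split=> [b k a a'|a k b b']; rewrite /tens_mul1 /=;
  (elim/tensor_ind: y => [|u v y IH]; first by rewrite !linear0 ?scaler0 addr0);
  rewrite !linearD /= {}IH !lift_tens ?scalerDr addrACA; congr (_ + _);
  rewrite /= /tens_mul2 mulrDl -scalerAl.
- by rewrite linearDl linearZl_LR.
- by rewrite linearDr linearZr_LR.
Qed.

HB.instance Definition _ y :=
  bilinear_isBilinear.Build K A B (tensor A B) *:%R *:%R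
    (tens_mul1 y) (tens_mul1_is_bilinear y).

Definition tens_mul (x y : tensor A B) : tensor A B := lift (tens_mul1 y) x.

Lemma tens_mulE a b a' b' :
  tens_mul (a \ox b) (a' \ox b') = (a * a') \ox (b * b').
Proof. by rewrite /tens_mul lift_tens /= /tens_mul1 lift_tens. Qed.

Lemma tens_mulDl : left_distributive tens_mul +%R.
Proof. by move=> x y z; rewrite /tens_mul linearD. Qed.

Lemma tens_mul_is_linear x : linear (tens_mul x).
Proof.
move=> k y z; rewrite /tens_mul.
elim/tensor_ind: x => [|u v x IH]; first by rewrite !linear0 ?scaler0 addr0.
rewrite !linearD /= {}IH !lift_tens ?scalerDr addrACA; congr (_ + _).
by rewrite /= /tens_mul1 linearP.
Qed.

HB.instance Definition _ x :=
  GRing.isLinear.Build K _ _ *:%R (tens_mul x) (tens_mul_is_linear x).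

Lemma tens_mulDr : right_distributive tens_mul +%R.
Proof. by move=> x y z; rewrite linearD. Qed.

Lemma tens_mul0l x : tens_mul 0 x = 0. Proof. by rewrite /tens_mul linear0. Qed.

Lemma tens_mulA : associative tens_mul.
Proof.
move=> x y z.
elim/tensor_ind: x => [|a b x IHx]; first by rewrite !tens_mul0l.
rewrite !tens_mulDl {}IHx; congr (_ + _).
elim/tensor_ind: y => [|a' b' y IHy]; first by rewrite tens_mul0l linear0 tens_mul0l.
rewrite tens_mulDl !tens_mulDr tens_mulDl {}IHy; congr (_ + _).
elim/tensor_ind: z => [|a'' b'' z IHz]; first by rewrite !linear0.
by rewrite !tens_mulDr {}IHz !tens_mulE !mulrA.
Qed.

Lemma tens_mul1x : left_id (1 \ox 1) tens_mul.
Proof.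
move=> x; elim/tensor_ind: x => [|a b x IH]; first by rewrite linear0.
by rewrite tens_mulDr tens_mulE !mul1r IH.
Qed.

Lemma tens_mulx1 : right_id (1 \ox 1) tens_mul.
Proof.
move=> x; elim/tensor_ind: x => [|a b x IH]; first by rewrite tens_mul0l.
by rewrite tens_mulDl tens_mulE !mulr1 IH.
Qed.

HB.instance Definition _ := GRing.Zmodule_isPzRing.Build (tensor A B)
  tens_mulA tens_mul1x tens_mulx1 tens_mulDl tens_mulDr.

Lemma tensM a b a' b' :
  (a \ox b) * (a' \ox b') = (a * a') \ox (b * b') :> tensor A B.
Proof. exact: tens_mulE. Qed.

Lemma tens1 : 1 = 1 \ox 1 :> tensor A B. Proof. by []. Qed.

End TensorAlgebra.

Section MultiplicationMap.
Variables (K : comNzRingType) (A : algType K).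

Definition mul_fun (a b : A) : A := a * b.

Lemma mul_fun_is_bilinear : bilinear_for *:%R *:%R mul_fun.
Proof.
split=> [v k a b|a k u v]; rewrite /mul_fun.
- by rewrite /= mulrDl -scalerAl.
- by rewrite /= mulrDr -scalerAr.
Qed.

HB.instance Definition _ :=
  bilinear_isBilinear.Build K A A A *:%R *:%R mul_fun mul_fun_is_bilinear.

Definition mul_map : {linear tensor A A -> A} := lift mul_fun.

Lemma mul_mapE a b : mul_map (a \ox b) = a * b.
Proof. exact: lift_tens. Qed.

End MultiplicationMap.

Arguments mul_map {K A}.

HB.mixin Record Algebra_isHopfAlgebra (K : fieldType) A
    of GRing.Algebra K A := {
  comul : {lrmorphism A -> tensor A A};
  counit : {lrmorphism A -> K^o};
  antipode : {linear A -> A};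
  comulA : forall x : A,
    tens_assoc (tens_map comul idfun (comul x)) =
    tens_map idfun comul (comul x);
  comul_counitl : forall x : A,
    tens_lunit (tens_map counit idfun (comul x)) = x;
  comul_counitr : forall x : A,
    tens_runit (tens_map idfun counit (comul x)) = x;
  antipodel : forall x : A,
    mul_map (tens_map antipode idfun (comul x)) = (counit x)%:A;
  antipoder : forall x : A,
    mul_map (tens_map idfun antipode (comul x)) = (counit x)%:A
}.

#[short(type="hopfAlgType")]
HB.structure Definition HopfAlgebra (K : fieldType) :=
  {A of GRing.Algebra K A & Algebra_isHopfAlgebra K A}.

Arguments comul {K s}.
Arguments counit {K s}.
Arguments antipode {K s}.

Definition weakly_finite (R : pzRingType) : Prop :=
  forall (n : nat) (x y : 'M[R]_n), (0 < n)%N ->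
    x *m y = 1%:M -> y *m x = 1%:M.

Section GroupLikeProjections.
Variables (K : fieldType) (A : hopfAlgType K).

Definition projection (P : A) : Prop := P * P = P.

Definition right_grouplike_projection (P : A) : Prop :=
  [/\ P != 0, projection P,
      comul P * (1 \ox P) = P \ox P & P \ox P = (1 \ox P) * comul P].

Local Open Scope classical_set_scope.

Definition calN (P : A) : set A :=
  [set x | comul x * (1 \ox P) = (1 \ox P) * comul x /\
           (1 \ox P) * comul x = x \ox P].

(* (mu (x) id) takes values in K (x) A, identified with A by [tens_lunit]. *)
Definition calV (P : A) : set A :=
  [set tens_lunit (tens_map mu idfun (comul P)) | mu in [set: {linear A -> K^o}]].

End GroupLikeProjections.

(* Main.v *)
Require Import Defs.
From HB Require Import structures.
From mathcomp Require Import all_boot all_order all_algebra.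
From mathcomp Require Import boolp classical_sets.

(** Take an expression [comul P = \sum_(i < d) w i \ox v i] of minimal length
    (Delta for [comul], S for the antipode). Both families are then linearly
    independent, so V = [calV P] is the span of the [v i]; it has dimension d.

    Coassociativity spreads the defining identities of P to the slices of
    Delta(P), so V is contained in N = [calN P] ([slice_in_calN]). In the other
    direction, every x in N satisfies
    (1 (x) x) Delta(P) = (S(x) (x) 1) Delta(P) ([lmul_comul]), whence
    x V <= V ([calN_mul]). So V is a left ideal of N, and everything reduces to
    1 being in V. Assume that it is not, and let B = K + V, an algebra of
    dimension d + 1.

    The span V is also a left coideal: Delta(v_i) = sum_j c_ij (x) v_j. If Q is a
    right B-module of dimension s on which v_j acts by the matrix rho_j, then
    v_i acts on A (x) Q by the matrix R_i = sum_j c_ij rho_j, and this action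
    commutes with left multiplication by A. Let n be the dimension of Q (x)_B V,
    that is, of the space of B-linear maps from Q to the dual of V.
    Coefficients in A turn Q (x)_B V into a free module: (A (x) Q) (x)_B V is A^n,
    because the antipode inverts the matrix (c_ij).

    Choose Q with n / s maximal ([exists_max_module]). Maximality gives a
    surjective left B-linear map F : B^n -> V^s; this is the statement dual to
    [exists_row_cogenerating]. Tensoring F with A (x) Q over B gives a surjective
    A-linear map from A^(s n) to A^(n s): a square matrix with a one-sided
    inverse. Here weak finiteness enters: the matrix is invertible. Since B acts
    faithfully on A (x) Q ([coaction_faithful]), F is injective, and therefore
    n (d + 1) <= s d. On the other hand the counit makes K a one-dimensional
    B-module of ratio at least 1, so n >= s by maximality: a contradiction
    ([matrix_coefficients_absurd]). *)

Set Implicit Arguments.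
Unset Strict Implicit.
Unset Printing Implicit Defensive.
Import GRing.Theory.
Local Open Scope ring_scope.

(** * Linear functionals on infinite-dimensional spaces *)

Definition lin_indep (K : fieldType) (V : lmodType K) (d : nat)
    (v : 'I_d -> V) : Prop :=
  forall x : 'I_d -> K, \sum_i x i *: v i = 0 -> forall i, x i = 0.

(** A subspace that is maximal among those containing M but not x is a complement
    of the line through x; the functional is the coordinate on that line. *)
Lemma exists_functional (K : fieldType) (V : lmodType K) (M : V -> Prop) (x : V) :
    M 0 -> (forall a u v, M u -> M v -> M (a *: u + v)) -> ~ M x ->
  exists mu : {linear V -> K^o}, mu x = 1 /\ forall u, M u -> mu u = 0.
Proof.
move=> M0 Mlin Mx.
(* The last clause lets the empty set through, as Zorn's lemma considers the
   empty chain; any nonempty member contains M. *)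
pose P (X : set V) := [/\ forall a u v, X u -> X v -> X (a *: u + v), ~ X x &
  forall z, X z -> forall u, M u -> X u].
have [F FP Ftot|X [[Xlin Xx XM] Xmax]] := @Zorn_bigcup V P.
  split=> [a u v [X FX Xu] [Y FY Yv]|[X FX Xx]|z [X FX Xz] u Mu].
  - have [XY|YX] := Ftot _ _ FX FY.
      by exists Y => //; have [Ylin _ _] := FP _ FY; apply: Ylin => //; apply: XY.
    by exists X => //; have [Xlin _ _] := FP _ FX; apply: Xlin => //; apply: YX.
  - by have [_ + _] := FP _ FX; apply.
  - by exists X => //; have [_ _ XM] := FP _ FX; apply: (XM z).
have {XM} XM u : M u -> X u.
  have [[z Xz]|X0] := pselect (exists z, X z); first exact: XM z Xz u.
  move=> _; exfalso; apply: (Xmax (fun u => M u)); last by split.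
  split=> [v Xv|/(_ 0 M0) X00]; first by exfalso; apply: X0; exists v.
  by apply: X0; exists 0.
have X0 : X 0 by apply: XM.
have Xk y : exists k, X (y - k *: x).
  have [Xy|Xy] := pselect (X y); first by exists 0; rewrite scale0r subr0.
  pose B u := exists a, X (u - a *: y).
  have XB u : X u -> B u by move=> Xu; exists 0; rewrite scale0r subr0.
  have Bx : B x.
    apply/not_notP => Bx; apply: (Xmax B); last first.
      split=> // [a u v [b Xb] [c Xc]|z _ u Mu]; last exact/XB/XM.
      exists (a * b + c).
      have -> : a *: u + v - (a * b + c) *: y = a *: (u - b *: y) + (v - c *: y).
        by rewrite scalerBr scalerDl scalerA opprD addrACA.
      exact: Xlin.
    split=> [u /XB//|/(_ y) BX]; apply/Xy/BX.
    by exists 1; rewrite scale1r subrr.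
  have [a Xa] := Bx; have [a0|a0] := eqVneq a 0.
    by case: Xx; move: Xa; rewrite a0 scale0r subr0.
  exists a^-1; have := Xlin (- a^-1) _ _ Xa X0.
  by rewrite addr0 scalerBr scalerA mulNr mulVf// !scaleNr scale1r opprK addrC.
have [mu Xmu] := choice Xk.
have mu_uniq y k : X (y - k *: x) -> mu y = k.
  move=> Xyk; apply/eqP; rewrite -subr_eq0; apply/eqP/not_notP => /eqP n0.
  apply: Xx; have := Xlin (-1) _ _ (Xmu y) Xyk.
  rewrite scaleN1r opprB addrA subrK -scalerBl => Xd.
  have := Xlin (mu y - k)^-1 _ _ Xd X0.
  by rewrite addr0 scalerA mulVf// scale1r.
have mu_lin : linear (mu : V -> K^o).
  move=> a u v; apply: mu_uniq.
  have -> : a *: u + v - (a *: (mu u : K^o) + mu v) *: x =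
     a *: (u - mu u *: x) + (v - mu v *: x).
    by rewrite scalerBr scalerDl scalerA opprD addrACA.
  exact: Xlin.
pose f : {linear V -> K^o} := HB.pack (mu : V -> K^o)
  (GRing.isLinear.Build K V K^o *:%R mu mu_lin).
exists f; split=> [|u Mu]; apply: mu_uniq; first by rewrite scale1r subrr.
by rewrite scale0r subr0; apply: XM.
Qed.

Lemma dual_functionals (K : fieldType) (V : lmodType K) (d : nat) (w : 'I_d -> V) :
  lin_indep w ->
  exists mu : 'I_d -> {linear V -> K^o}, forall i j, mu i (w j) = (i == j)%:R.
Proof.
move=> wI; suff: forall i, exists mu : {linear V -> K^o},
    forall j, mu (w j) = (i == j)%:R.
  by move=> /choice[mu muP]; exists mu.
move=> i.
pose M u := exists2 x : 'I_d -> K, x i = 0 & u = \sum_j x j *: w j.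
have [|a _ _ [x x0 ->] [y y0 ->]|[x x0 wx]|mu [mu1 mu0]] :=
    @exists_functional _ _ M (w i).
- by exists (fun=> 0) => //; rewrite big1// => j _; rewrite scale0r.
- exists (fun j => a * x j + y j); first by rewrite x0 y0 mulr0 addr0.
  rewrite scaler_sumr -big_split; apply: eq_bigr => j _ /=.
  by rewrite scalerDl scalerA.
- have /(_ i) : forall j, x j - (j == i)%:R = 0.
    apply: wI; under eq_bigr do rewrite scalerBl.
    rewrite sumrB -wx (bigD1 i)//= eqxx scale1r big1 ?addr0 ?subrr// => j /negPf->.
    by rewrite scale0r.
  by move/eqP; rewrite x0 eqxx sub0r oppr_eq0 oner_eq0.
exists mu => j; have [<-//|ij] := eqVneq; apply: mu0.
exists (fun k => (k == j)%:R); first by rewrite (negPf ij).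
rewrite (bigD1 j)//= eqxx scale1r big1 ?addr0// => k /negPf->.
by rewrite scale0r.
Qed.

Lemma functional_separates (K : fieldType) (V : lmodType K) (x : V) :
  (forall mu : {linear V -> K^o}, mu x = 0) -> x = 0.
Proof.
move=> x0; apply/not_notP => xn0.
have [//|a u v -> ->|//|mu [mu1 _]] := @exists_functional _ _ (fun u => u = 0) x.
  by rewrite scaler0 addr0.
by have /eqP := mu1; rewrite x0 eq_sym oner_eq0.
Qed.

(** * Submodules of a finite-dimensional module *)

Section Vspace.
Variables (K : fieldType) (W : vectType K).

Lemma vspace_of_pred (p : W -> Prop) :
    p 0 -> (forall a x y, p x -> p y -> p (a *: x + y)) ->
  exists U : {vspace W}, forall x, x \in U <-> p x.
Proof.
move=> p0 plin.
pose Q n := `[< exists U : {vspace W}, (forall x, x \in U -> p x) /\ \dim U = n >].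
have [||n /asboolP[U [Up <-]] Umax] := @ex_maxnP Q (\dim {:W}).
- by exists 0; apply/asboolP; exists 0%VS; rewrite dimv0; split=> // x /[!memv0]/eqP->.
- by move=> n /asboolP[U [_ <-]]; rewrite dimvS ?subvf.
exists U => x; split=> [/Up//|px].
suff /eqP -> : U == (U + <[x]>)%VS by rewrite memvE addvSr.
rewrite eqEdim addvSl /= Umax//; apply/asboolP; exists (U + <[x]>)%VS; split=> // y.
case/memv_addP => u Uu [_ /vlineP[k ->] ->].
by rewrite addrC; apply: plin => //; apply: Up.
Qed.

Variables (I : Type) (L : I -> 'End(W)).

Definition stable (U : {vspace W}) : Prop :=
  forall i x, x \in U -> L i x \in U.

Definition simple_sub (T : {vspace W}) : Prop :=
  [/\ T != 0%VS, stable T & forall Y, stable Y -> (Y <= T)%VS -> Y != 0%VS -> Y = T].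

Lemma exists_simple_sub (Y : {vspace W}) : stable Y -> Y != 0%VS ->
  exists2 T, simple_sub T & (T <= Y)%VS.
Proof.
move=> sY Y0; pose Q n := `[< exists T : {vspace W},
   [/\ T != 0%VS, stable T, (T <= Y)%VS & \dim T = n] >].
have [|n /asboolP[T [T0 sT TY <-]] Tmin] := @ex_minnP Q.
  by exists (\dim Y); apply/asboolP; exists Y.
exists T => //; split=> // Z sZ ZT Z0; apply/eqP; rewrite eqEdim ZT Tmin//.
by apply/asboolP; exists Z; rewrite (subv_trans ZT).
Qed.

Lemma stable_cap U V : stable U -> stable V -> stable (U :&: V)%VS.
Proof. by move=> sU sV i x; rewrite !memv_cap => /andP[/sU-> /sV->]. Qed.

Lemma stable_add U V : stable U -> stable V -> stable (U + V)%VS.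
Proof.
move=> sU sV i x /memv_addP[u Uu [v Vv ->]].
by rewrite linearD memv_add ?sU ?sV.
Qed.

Lemma stable0 : stable 0%VS.
Proof. by move=> i x /[!memv0]/eqP->; rewrite linear0. Qed.

(** A linear map [Lam] on a module W is cogenerating if its kernel contains no
    nonzero submodule. Take a submodule U of maximal dimension among those on
    which some [Lam] is cogenerating. If [Lam] fails on W, its kernel contains a
    simple submodule T, and T meets U trivially. Subtract from [Lam] a map [th]
    supported on T: on T + U this fails only if some submodule of T + U in the
    kernel is the graph of a module map y : T -> W with [Lam \o y = th] on T.
    The hypothesis provides a [th] that is not of this form. *)
Lemma exists_cogenerating (E : vectType K) :
    (forall (Lam : 'Hom(W, E)) (T : {vspace W}), simple_sub T ->
       (T <= lker Lam)%VS ->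
       exists th : 'Hom(W, E), forall y : 'End(W),
         (forall i x, x \in T -> y (L i x) = L i (y x)) ->
         exists2 x, x \in T & Lam (y x) <> th x) ->
  exists Lam : 'Hom(W, E), forall Y, stable Y -> (Y <= lker Lam)%VS -> Y = 0%VS.
Proof.
move=> perturb.
pose good U (Lam : 'Hom(W, E)) := stable U /\
  forall Y, stable Y -> (Y <= U)%VS -> (Y <= lker Lam)%VS -> Y = 0%VS.
pose Q n := `[< exists U Lam, good U Lam /\ \dim U = n >].
have [||n /asboolP[U [Lam [[sU gU] <-]]] Umax] := @ex_maxnP Q (\dim {:W}).
- exists 0; apply/asboolP; exists 0%VS, 0; rewrite dimv0; split=> //; split.
    exact: stable0.
  by move=> Y _; rewrite subv0 => /eqP->.
- by move=> n /asboolP[U [_ [_ <-]]]; rewrite dimvS ?subvf.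
exists Lam => Y sY YLam; apply/eqP/not_notP => /negP Y0.
have [T simT TY] := exists_simple_sub sY Y0.
have TLam := subv_trans TY YLam; have [T0 sT minT] := simT.
have TU : (T :&: U)%VS = 0%VS.
  apply: gU; [exact: stable_cap|exact: capvSr|exact: subv_trans (capvSl _ _) _].
have [th thP] := perturb Lam T simT TLam.
pose s := daddv_pi T U.
have sid x : x \in T -> s x = x by move=> Tx; rewrite [LHS]daddv_pi_id.
have s0 x : x \in U -> s x = 0.
  move=> Ux; apply: (addIr x); rewrite add0r.
  by rewrite -[RHS](daddv_pi_add TU (subvP (addvSr T U) _ Ux))
    (@daddv_pi_id _ _ U T)// capvC.
pose Lam' := (Lam - (th \o s))%VF.
have Lam'E x : Lam' x = Lam x - th (s x) by rewrite add_lfunE opp_lfunE comp_lfunE.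
suff gTU : good (T + U)%VS Lam'.
  have /Umax : Q (\dim (T + U)%VS) by apply/asboolP; exists (T + U)%VS, Lam'.
  by rewrite dimv_disjoint_sum// -[leqRHS]add0n leq_add2r leqn0 dimv_eq0 (negPf T0).
split; first exact: stable_add.
move=> Z sZ ZTU ZLam'.
have ZU : (Z :&: U)%VS = 0%VS.
  apply: gU; [exact: stable_cap|exact: capvSr|].
  apply/subvP => x; rewrite memv_cap memv_ker => /andP[/(subvP ZLam')].
  by rewrite memv_ker Lam'E => Lx /s0 sx; rewrite sx linear0 subr0 in Lx.
have sL i x : x \in (T + U)%VS -> s (L i x) = L i (s x).
  case/memv_addP => a Ta [b Ub ->]; rewrite !linearD /=.
  by rewrite (sid a)// (sid _ (sT i _ Ta)) (s0 b)// (s0 _ (sU i _ Ub)) linear0.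
have sinj x : x \in Z -> s x = 0 -> x = 0.
  move=> Zx sx; have := daddv_pi_add TU (subvP ZTU _ Zx).
  rewrite -/s sx add0r => xU; apply/eqP; rewrite -memv0 -ZU memv_cap Zx -xU.
  exact: memv_pi.
apply/eqP/not_notP => /negP Z0.
have sZT : (s @: Z)%VS = T.
  apply: minT.
  - move=> i _ /memv_imgP[x Zx ->].
    by rewrite -sL ?(subvP ZTU)//; apply/memv_img/sZ.
  - by apply/subvP => _ /memv_imgP[x _ ->]; apply: memv_pi.
  - rewrite -dimv_eq0 limg_dim_eq ?dimv_eq0//; apply/eqP; rewrite -subv0.
    apply/subvP => x; rewrite memv_cap memv_ker memv0 => /andP[Zx /eqP].
    by move=> /sinj->.
pose g := (s \o projv Z)%VF.
have gT : limg g = T by rewrite limg_comp limg_proj.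
(* The inverse of the projection of Z onto T, extended arbitrarily. *)
pose y := (projv Z \o g^-1)%VF.
have yZ x : y x \in Z by rewrite comp_lfunE memv_proj.
have sy x : x \in T -> s (y x) = x.
  by rewrite -{1}gT => Tx; rewrite comp_lfunE -[s _]comp_lfunE limg_lfunVK.
have [i x Tx|x Tx] := thP y.
  apply/eqP; rewrite -subr_eq0; apply/eqP/sinj.
    by rewrite memvB ?yZ ?sZ.
  by rewrite linearB /= sL ?(subvP ZTU)// !sy ?subrr// sT.
apply; have := yZ x => /(subvP ZLam'); rewrite memv_ker Lam'E sy//.
by rewrite subr_eq0 => /eqP.
Qed.

End Vspace.

(** * Modules given by structure constants *)

(** The algebra has a basis v with [v i * v j = \sum_p M i p j *: v p]. Vectors
    are rows, so that [u *m rho j] is the action of [v j] on a right module. For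
    [rho = M] this is the dual of the algebra itself: a row is a functional on
    the span of v, and [v j] acts by precomposition with left multiplication. *)
Section Multiplicities.
Variables (K : fieldType) (d : nat) (M : 'I_d -> 'M[K]_d).

Definition is_module s (rho : 'I_d -> 'M[K]_s) : Prop :=
  forall i j, rho i *m rho j = \sum_p M i p j *: rho p.

Definition hom_space s (rho : 'I_d -> 'M[K]_s) (U : {vspace 'M[K]_(s, d)}) :=
  forall h, h \in U <-> forall j, rho j *m h = h *m M j.

Lemma exists_hom_space s (rho : 'I_d -> 'M[K]_s) : exists U, hom_space rho U.
Proof.
apply: vspace_of_pred => [j|a x y px py j]; first by rewrite mulmx0 mul0mx.
by rewrite mulmxDr -scalemxAr px py mulmxDl scalemxAl.
Qed.

Definition row_action k (j : 'I_d) : 'End('M[K]_(k, d)) := linfun (mulmxr (M j)).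

Lemma row_actionE k j (x : 'M_(k, d)) : row_action k j x = x *m M j.
Proof. by rewrite lfunE. Qed.

(** In a basis of T, the action on a simple submodule T of the k-fold power of
    the dual is given by matrices. Some coordinate embeds T in the dual itself,
    which bounds its dimension by d. *)
Lemma simple_multiplicity k (T : {vspace 'M[K]_(k, d)}) :
    is_module M -> simple_sub (@row_action k) T ->
  exists (a : 'I_d -> 'M[K]_(\dim T)),
    [/\ (0 < \dim T <= d)%N, is_module a &
      forall (i : 'I_(\dim T)) j,
        (vbasis T)`_i *m M j = \sum_i' a j i i' *: (vbasis T)`_i'].
Proof.
move=> Mmod [T0 sT minT].
pose b := vbasis T; have bT i : b`_i \in T.
  have [lt_i|ge_i] := ltnP i (\dim T); last by rewrite nth_default ?mem0v ?size_tuple.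
  by apply: vbasis_mem; rewrite mem_nth ?size_tuple.
pose a j : 'M[K]_(\dim T) := \matrix_(i, i') coord b i' (b`_i *m M j).
have aE (i : 'I_(\dim T)) j : b`_i *m M j = \sum_i' a j i i' *: b`_i'.
  have xT : b`_i *m M j \in T by rewrite -row_actionE sT.
  by rewrite [LHS](coord_vbasis xT); apply: eq_bigr => i' _; rewrite mxE.
have bfree := basis_free (vbasisP T).
exists a; split=> //.
  rewrite lt0n dimv_eq0 T0 /=.
  have [x Tx x0] : exists2 x, x \in T & x != 0.
    by exists (vpick T); rewrite ?memv_pick ?vpick0.
  have [l xl] : exists l, row l x != 0.
    apply/not_existsP => xl; move/eqP: x0; apply; apply/row_matrixP => l.
    by rewrite row0; apply/eqP/negPn/negP/xl.
  pose f := linfun (row l : 'M[K]_(k, d) -> 'rV_d).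
  have kf0 : (T :&: lker f)%VS = 0%VS.
    apply/eqP/not_notP => /negP kf0; move: xl.
    have sker : stable (@row_action k) (T :&: lker f)%VS.
      apply: stable_cap => // i y; rewrite !memv_ker !lfunE /= => /eqP yl.
      by rewrite row_mul yl mul0mx.
    have kT := minT _ sker (capvSl _ _) kf0.
    move: Tx; rewrite -kT memv_cap memv_ker lfunE /= => /andP[_ /eqP->].
    by rewrite eqxx.
  rewrite -(limg_dim_eq kf0) (leq_trans (dimvS (subvf _)))// dimvf.
  by rewrite dim_matrix mul1r.
move=> p q; apply/matrixP => i i'.
have : b`_i *m M p *m M q = b`_i *m (M p *m M q) by rewrite mulmxA.
rewrite aE mulmx_suml Mmod mulmx_sumr.
under eq_bigr do rewrite -scalemxAl aE scaler_sumr.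
under [in RHS]eq_bigr do rewrite -scalemxAr aE scaler_sumr.
rewrite exchange_big [in RHS]exchange_big /=.
under eq_bigr do under eq_bigr do rewrite scalerA.
under [in RHS]eq_bigr do under eq_bigr do rewrite scalerA.
under eq_bigr do rewrite -scaler_suml.
under [in RHS]eq_bigr do rewrite -scaler_suml.
move=> /(congr1 (coord b i')); rewrite !coord_sum_free// => e.
rewrite !mxE [LHS]e summxE; apply: eq_bigr => r _.
by rewrite !mxE.
Qed.

(** With W the k-fold power of the dual, maps from a simple T into W form a space
    of dimension [k * \dim U], at most the dimension [n * t] of the space of
    linear maps from T to K^n. Composition with [Lam] is not injective between
    these spaces when [Lam] kills T, as it kills the inclusion of T; so it is not
    surjective, which is what [exists_cogenerating] asks for. *)
Lemma exists_row_cogenerating k n :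
    is_module M ->
    (forall t (a : 'I_d -> 'M[K]_t) U, (0 < t <= d)%N -> is_module a ->
       hom_space a U -> (k * \dim U <= n * t)%N) ->
  exists Lam : 'Hom('M[K]_(k, d), 'rV[K]_n),
    forall Y, stable (@row_action k) Y -> (Y <= lker Lam)%VS -> Y = 0%VS.
Proof.
move=> Mmod small; apply: exists_cogenerating => Lam T simT TLam.
have [a [t_bnd amod]] := simple_multiplicity Mmod simT.
set t := \dim T in a t_bnd amod *; set b := vbasis T => aE.
have [T0 sT _] := simT.
have [U UP] := exists_hom_space a.
have kU := small _ _ _ t_bnd amod UP.
have bfree := basis_free (vbasisP T).
have bT (i : 'I_t) : b`_i \in T.
  by apply: vbasis_mem; rewrite mem_nth ?size_tuple.
pose y (z : 'M[K]_(k, \dim U)) (i : 'I_t) : 'M[K]_(k, d) :=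
  \matrix_l row i (\sum_p z l p *: (vbasis U)`_p).
have y_lin c z z' i : y (c *: z + z') i = c *: y z i + y z' i.
  apply/row_matrixP => l; rewrite linearP /= !rowK -linearP /=.
  rewrite scaler_sumr -big_split; congr (row i _); apply: eq_bigr => p _ /=.
  by rewrite !mxE scalerDl scalerA.
have y_onto (f : 'End('M[K]_(k, d))) :
    (forall j x, x \in T -> f (row_action k j x) = row_action k j (f x)) ->
    exists z, forall i, y z i = f b`_i.
  move=> fP; pose h l : 'M[K]_(t, d) := \matrix_i row l (f b`_i).
  have hU l : h l \in U.
    apply/UP => j; apply/row_matrixP => i; rewrite !row_mul rowK.
    rewrite -[RHS]row_mul -row_actionE -fP// row_actionE aE.
    rewrite mulmx_sum_row; under eq_bigr do rewrite rowK mxE.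
    by rewrite !linear_sum; apply: eq_bigr => i' _; rewrite !linearZ.
  exists (\matrix_(l, p) coord (vbasis U) p (h l)) => i.
  apply/row_matrixP => l; rewrite rowK.
  under eq_bigr do rewrite mxE.
  by rewrite -(coord_vbasis (hU l)) rowK.
pose G0 (z : 'M[K]_(k, \dim U)) : 'M[K]_(t, n) := \matrix_i Lam (y z i).
have G0_lin : linear G0.
  by move=> c z z'; apply/row_matrixP => i; rewrite linearP /= !rowK y_lin linearP.
pose G1 : {linear 'M[K]_(k, \dim U) -> 'M[K]_(t, n)} := HB.pack G0
  (GRing.isLinear.Build _ _ _ _ G0 G0_lin).
pose G := linfun G1.
have GE z i : row i (G z) = Lam (y z i) by rewrite lfunE /= rowK.
have kerG : (0 < \dim (lker G))%N.
  have [|z zP] := y_onto \1%VF; first by move=> j x _; rewrite !id_lfunE.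
  rewrite lt0n dimv_eq0; apply: contraNneq T0 => kerG0.
  have : z \in lker G.
    rewrite memv_ker; apply/eqP/row_matrixP => i.
    rewrite GE row0 zP id_lfunE; apply/eqP.
    by rewrite -memv_ker (subvP TLam).
  rewrite kerG0 memv0 => /eqP z0.
  rewrite -subv0 -(span_basis (vbasisP T)); apply/span_subvP => x.
  move=> /(nthP 0)[i]; rewrite size_tuple => lt_i <-.
  have := zP (Ordinal lt_i); rewrite id_lfunE /= => <-.
  rewrite z0 memv0; apply/eqP/row_matrixP => l; rewrite rowK row0.
  by rewrite big1 ?row0// => p _; rewrite mxE scale0r.
apply/not_existsP => no_th.
have imG : limg G = fullv.
  apply/eqP; rewrite eqEsubv subvf; apply/subvP => th _.
  pose th0 (x : 'M[K]_(k, d)) : 'rV[K]_n := (\row_i coord b i x) *m th.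
  have th_lin : linear th0.
    move=> c x x'; rewrite /th0 scalemxAl -mulmxDl; congr (_ *m _).
    by apply/rowP => i; rewrite !mxE linearP.
  pose th1 : {linear 'M[K]_(k, d) -> 'rV[K]_n} := HB.pack th0
    (GRing.isLinear.Build _ _ _ _ th0 th_lin).
  have /existsNP[f /not_implyP[fP fth]] := no_th (linfun th1).
  have [z zP] := y_onto f fP.
  have -> : th = G z; last exact: memv_img (memvf _).
  apply/row_matrixP => i; rewrite GE zP.
  have -> : Lam (f b`_i) = linfun th1 b`_i.
    by apply/not_notP => ne; apply: fth; exists b`_i.
  rewrite lfunE /= /th0 rowE; congr (_ *m _).
  apply/rowP => i'; rewrite !mxE coord_free//= .
  by rewrite eq_sym.
have e : (\dim (lker G) + t * n = k * \dim U)%N.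
  by have := limg_ker_dim G fullv; rewrite capfv imG !dimvf !dim_matrix.
move: kU; rewrite leqNgt => /negP; apply.
by rewrite -e [ltnLHS]mulnC -[ltnLHS]add0n ltn_add2r.
Qed.
End Multiplicities.

Section MaxModule.
Variables (K : fieldType) (d : nat) (M : 'I_d -> 'M[K]_d).

(** The ratio of [\dim U], the multiplicity, to s takes finitely many values for
    modules of dimension at most d. The character e spans a one-dimensional
    submodule of the dual, so the maximal ratio is at least 1. *)
Lemma exists_max_module (e : 'rV[K]_d) :
    is_module M M -> e != 0 -> (forall j, e *m M j = e 0 j *: e) ->
  exists s (rho : 'I_d -> 'M[K]_s) (U : {vspace 'M[K]_(s, d)}),
    [/\ (0 < s <= d)%N, is_module M rho, hom_space M rho U, (s <= \dim U)%N &
      forall t (a : 'I_d -> 'M[K]_t) U', (0 < t <= d)%N -> is_module M a ->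
        hom_space M a U' -> (s * \dim U' <= \dim U * t)%N].
Proof.
move=> Mmod e0 eM.
pose Q t h := exists (a : 'I_d -> 'M[K]_t) (U : {vspace 'M[K]_(t, d)}),
  [/\ (0 < t <= d)%N, is_module M a, hom_space M a U & \dim U = h].
have d_gt0 : (0 < d)%N.
  rewrite lt0n; apply: contraNneq e0 => d0; apply/eqP/rowP => i.
  by have := ltn_ord i; rewrite [X in (_ < X)%N]d0.
have Qbound t h : Q t h -> (t < d.+1)%N /\ (h < (d * d).+1)%N.
  case=> a [U [/andP[_ td] _ _ <-]]; split=> //; rewrite ltnS.
  by rewrite (leq_trans (dimvS (subvf _)))// dimvf dim_matrix leq_mul2r td orbT.
have [h1 h1_gt0 Qh1] : exists2 h, (0 < h)%N & Q 1%N h.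
  pose a j : 'M[K]_1 := (e 0 j)%:M.
  have [U UP] := exists_hom_space M a.
  exists (\dim U); last first.
    exists a, U; split=> // i j; rewrite -scalar_mxM.
    have /rowP/(_ j) := eM i; rewrite !mxE => <-.
    rewrite raddf_sum /=; apply: eq_bigr => p _.
    by rewrite scale_scalar_mx mulrC.
  rewrite lt0n dimv_eq0; apply: contraNneq e0 => U0.
  by rewrite -memv0 -U0; apply/UP => j; rewrite mul_scalar_mx eM.
have [_ hlt] := Qbound _ _ Qh1.
pose R (th : 'I_d.+1 * 'I_(d * d).+1) := `[< Q th.1 th.2 >].
pose F (th : 'I_d.+1 * 'I_(d * d).+1) : rat := th.2%:R / th.1%:R.
have R0 : R (inord 1, inord h1) by apply/asboolP; rewrite /= !inordK.
case: (Order.TotalTheory.arg_maxP F R0) => -[s h].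
move=> /asboolP[/= rho [U [sd rhomod UP Uh]]] max.
have smax t h' : Q t h' -> (s * h' <= h * t)%N.
  move=> Qth; have [td h'd] := Qbound _ _ Qth.
  have /max : R (inord t, inord h') by apply/asboolP; rewrite /= !inordK.
  rewrite /F /= !inordK// Num.Theory.ler_pdivrMr.
    rewrite mulrAC Num.Theory.ler_pdivlMr -?natrM ?Num.Theory.ler_nat 1?mulnC//.
    by rewrite Num.Theory.ltr0n; case/andP: sd.
  by rewrite Num.Theory.ltr0n; case: Qth => ? [? [/andP[]]].
exists s, rho, U; split=> //.
  rewrite Uh; have := smax _ _ Qh1; rewrite muln1; apply: leq_trans.
  by rewrite leq_pmulr.
by move=> t a U' td amod UP'; rewrite Uh; apply: smax; exists a, U'.
Qed.
End MaxModule.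

(** * Weak finiteness and the matrix coefficients *)

Lemma weakly_finite_index (R : pzRingType) (I : finType) (X Y : I -> I -> R) :
    weakly_finite R ->
    (forall a c, \sum_b X a b * Y b c = (a == c)%:R) ->
  forall a c, \sum_b Y a b * X b c = (a == c)%:R.
Proof.
move=> wfR XY a c; have I_gt0 : (0 < #|I|)%N by apply/card_gt0P; exists a.
pose mx (Z : I -> I -> R) := \matrix_(i < #|I|, j < #|I|) Z (enum_val i) (enum_val j).
have mxM Z Z' i j : (mx Z *m mx Z') i j =
    \sum_b Z (enum_val i) b * Z' b (enum_val j).
  rewrite mxE [RHS](reindex (@enum_val _ I)) /=; last exact: onW_bij (enum_val_bij _).
  by apply: eq_bigr => k _; rewrite !mxE.
have XY1 : mx X *m mx Y = 1%:M.
  by apply/matrixP => i j; rewrite mxM XY mxE (inj_eq enum_val_inj).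
have /matrixP/(_ (enum_rank a) (enum_rank c)) := wfR _ _ _ I_gt0 XY1.
by rewrite mxM mxE !enum_rankK (inj_eq enum_rank_inj).
Qed.

Lemma coef_sum (K : fieldType) (V : lmodType K) (I J : finType) (a : I -> J -> K)
    (b : I -> K) (x : J -> V) :
  \sum_i b i *: \sum_j a i j *: x j = \sum_j (\sum_i b i * a i j) *: x j.
Proof.
under eq_bigr do rewrite scaler_sumr.
rewrite exchange_big; apply: eq_bigr => j _ /=.
by rewrite scaler_suml; apply: eq_bigr => i _; rewrite scalerA.
Qed.

Lemma sum_delta (K : fieldType) (V : lmodType K) (I : finType) (i : I) (x : I -> V) :
  \sum_j (i == j)%:R *: x j = x i.
Proof.
rewrite (bigD1 i)//= eqxx scale1r big1 ?addr0// => j.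
by rewrite eq_sym => /negPf->; rewrite scale0r.
Qed.

Lemma sum_scale_delta (K : fieldType) (A : algType K) (I : finType) (i : I)
    (x : I -> K) :
  \sum_j x j *: (i == j)%:R = x i *: 1 :> A.
Proof.
rewrite -(sum_delta i (fun j => x j *: (1 : A))); apply: eq_bigr => j _.
by case: eqP => _; rewrite ?scale1r// scaler0 scale0r.
Qed.

Lemma mul_lin_comb (K : fieldType) (A : algType K) (I J : finType) (a : I -> K)
    (b : J -> K) (x : I -> A) (y : J -> A) :
  (\sum_i a i *: x i) * (\sum_j b j *: y j) =
  \sum_i \sum_j (a i * b j) *: (x i * y j).
Proof.
rewrite mulr_suml; apply: eq_bigr => i _; rewrite mulr_sumr.
by apply: eq_bigr => j _; rewrite -scalerAl -scalerAr scalerA.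
Qed.

Section Contradiction.
Variables (K : fieldType) (A : algType K) (d : nat) (M : 'I_d -> 'M[K]_d).
(* M holds the structure constants of an algebra V with basis v, c the
   coefficients of its coaction v_i |-> sum_j c_ij (x) v_j, sc their images under
   the antipode, e the counit. *)
Variables (c sc : 'I_d -> 'I_d -> A) (e : 'rV[K]_d).
Hypothesis wfA : weakly_finite A.
Hypothesis Mmod : is_module M M.
Hypothesis scK : forall t r, \sum_i sc t i * c i r = (t == r)%:R.
(* The coaction is multiplicative. *)
Hypothesis cM : forall q i t,
  \sum_a \sum_b M a t b *: (c q a * c i b) = \sum_r M q r i *: c r t.
Hypothesis e0 : e != 0.
Hypothesis eM : forall j, e *m M j = e 0 j *: e.
(* V is spanned by the products of its elements. *)
Hypothesis M_nondeg : forall l : 'rV[K]_d, (forall j, l *m M j = 0) -> l = 0.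
(* The coaction twists rho into a faithful action of K + V. *)
Hypothesis faithful : forall s (rho : 'I_d -> 'M[K]_s), is_module M rho ->
  (exists j, rho j != 0) -> forall x0 (x : 'I_d -> K),
  (forall p q : 'I_s,
     (x0 *+ (p == q)) *: 1 + \sum_i x i *: \sum_j rho j p q *: c i j = 0) ->
  x0 = 0 /\ forall i, x i = 0.

Lemma matrix_coefficients_absurd : False.
Proof.
have [s [rho [U [/andP[s_gt0 sd] rhomod UP sU Umax]]]] := exists_max_module Mmod e0 eM.
set n : nat := \dim U in sU Umax *.
pose eta := vbasis U.
have etaU (p : 'I_n) : eta`_p \in U.
  by apply: vbasis_mem; rewrite mem_nth ?size_tuple.
have etaM (p : 'I_n) j : rho j *m eta`_p = eta`_p *m M j by have /UP := etaU p.
have rho0 : exists j, rho j != 0.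
  apply/not_existsP => rho0; have : (0 < \dim U)%N by apply: leq_trans sU.
  rewrite lt0n dimv_eq0 => /negP; apply; rewrite -subv0; apply/subvP => h /UP hM.
  rewrite memv0; apply/eqP/row_matrixP => i; rewrite row0; apply: M_nondeg => j.
  rewrite -row_mul -hM; have /negP/negPn/eqP-> := rho0 j.
  by rewrite mul0mx row0.
have [Lam LamP] := @exists_row_cogenerating K d M s n Mmod Umax.
(* From here on the index set 'I_d.+1 stands for the basis 1, v_0, ..., v_(d-1)
   of B = K + V, with 1 at ord0. [Mb] gives left multiplication on V, and [Rb]
   the action on A (x) Q, for the module Q given by rho. *)
pose Mb (q : 'I_d.+1) := if unlift ord0 q is Some i then M i else 1%:M.
have Mb0 : Mb ord0 = 1%:M by rewrite /Mb unlift_none.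
have MbS (i : 'I_d) : Mb (fintype.lift ord0 i) = M i by rewrite /Mb liftK.
pose Rb (q : 'I_d.+1) u u' : A :=
  if unlift ord0 q is Some i then \sum_a rho a u u' *: c i a else (u == u')%:R.
have Rb0 u u' : Rb ord0 u u' = (u == u')%:R by rewrite /Rb unlift_none.
have RbS (i : 'I_d) u u' :
    Rb (fintype.lift ord0 i) u u' = \sum_a rho a u u' *: c i a.
  by rewrite /Rb liftK.
(* [N i] is the pairing of A (x) Q with v_i; it takes values in A^n, as the maps
   eta_p are the coordinates of Q (x)_B V. *)
pose N i u (p : 'I_n) : A := \sum_r eta`_p u r *: c i r.
have RbN q i u p : \sum_u' Rb q u u' * N i u' p = \sum_r Mb q r i *: N r u p.
  case: (unliftP ord0 q) => [q' ->|->]; last first.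
    rewrite Mb0; under [RHS]eq_bigr do rewrite mxE eq_sym.
    rewrite sum_delta; under eq_bigr do rewrite Rb0 -scaler_nat -scalerAl mul1r.
    by rewrite sum_delta.
  transitivity (\sum_a \sum_b (\sum_u' rho a u u' * eta`_p u' b) *: (c q' a * c i b)).
    under eq_bigr => u' _.
      rewrite RbS mulr_suml; under eq_bigr => a _.
        rewrite mulr_sumr; under eq_bigr do rewrite -scalerAl -scalerAr scalerA.
        over.
      over.
    rewrite exchange_big; apply: eq_bigr => a _ /=.
    rewrite exchange_big; apply: eq_bigr => b _ /=.
    by rewrite scaler_suml.
  under eq_bigr => a _.
    under eq_bigr => b _.
      have -> : \sum_u' rho a u u' * eta`_p u' b = \sum_t eta`_p u t * M a t b.
        by have /matrixP/(_ u b) := etaM p a; rewrite !mxE.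
      over.
    rewrite -coef_sum; over.
  rewrite /= exchange_big /=; under eq_bigr do rewrite -scaler_sumr cM.
  under eq_bigr do rewrite scaler_sumr.
  rewrite exchange_big; apply: eq_bigr => r _; rewrite /= MbS scaler_sumr.
  by apply: eq_bigr => t _; rewrite !scalerA mulrC.
(* The rows eta_p are independent, hence have a right inverse [N'] over K; the
   antipode transports it to a left inverse [Y] of the family [N] over A. *)
pose N' (p : 'I_n) (u : 'I_s) (t : 'I_d) : K := coord eta p (delta_mx u t).
have N'eta (p p' : 'I_n) : \sum_u \sum_t N' p' u t * eta`_p u t = (p == p')%:R.
  rewrite -(coord_free p p' (basis_free (vbasisP U))).
  rewrite [X in coord _ _ X]matrix_sum_delta linear_sum; apply: eq_bigr => u _ /=.
  by rewrite linear_sum; apply: eq_bigr => t _; rewrite linearZ /= mulrC.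
pose Y (p : 'I_n) (i : 'I_d) (u : 'I_s) : A := \sum_t N' p u t *: sc t i.
have YN p p' : \sum_i \sum_u Y p' i u * N i u p = (p == p')%:R.
  rewrite exchange_big /=.
  transitivity ((p == p')%:R%:A : A); last by rewrite scaler_nat.
  rewrite -N'eta scaler_suml; apply: eq_bigr => u _; rewrite scaler_suml.
  under eq_bigr do rewrite mul_lin_comb.
  rewrite exchange_big; apply: eq_bigr => t _ /=; rewrite exchange_big /=.
  under eq_bigr do rewrite -scaler_sumr scK.
  by rewrite sum_scale_delta.
(* [th] is the transpose of F : B^n -> V^s, the left linear map that sends the
   j-th basis vector to the j-th component of [Lam]. Its kernel is a submodule
   in the kernel of [Lam], hence zero, and [G] is a left inverse of [th]. *)
pose th0 (x : 'M[K]_(s, d)) : 'M[K]_(n, d.+1) :=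
  \matrix_(j, q) Lam (x *m Mb q) 0 j.
have th_lin : linear th0.
  by move=> a x y; apply/matrixP => j q; rewrite !mxE mulmxDl -scalemxAl linearP !mxE.
pose th1 : {linear 'M[K]_(s, d) -> 'M[K]_(n, d.+1)} := HB.pack th0
  (GRing.isLinear.Build _ _ _ _ th0 th_lin).
pose th := linfun th1.
have thE x j q : th x j q = Lam (x *m Mb q) 0 j by rewrite lfunE /= mxE.
have thM0 x i j : th (x *m M i) j ord0 = th x j (fintype.lift ord0 i).
  by rewrite !thE Mb0 mulmx1 MbS.
have thMS x i j q : th (x *m M i) j (fintype.lift ord0 q) =
    \sum_p M i p q * th x j (fintype.lift ord0 p).
  rewrite thE MbS -mulmxA Mmod mulmx_sumr linear_sum summxE; apply: eq_bigr => p _.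
  by rewrite -scalemxAr linearZ mxE thE MbS.
have th_inj : lker th == 0%VS.
  apply/eqP/LamP.
    move=> i x; rewrite row_actionE !memv_ker => /eqP thx.
    apply/eqP/matrixP => j q; rewrite [RHS]mxE.
    case: (unliftP ord0 q) => [q' ->|->]; last by rewrite thM0 thx mxE.
    by rewrite thMS big1// => p _; rewrite thx mxE mulr0.
  apply/subvP => x; rewrite !memv_ker => /eqP thx.
  by apply/eqP/rowP => j; rewrite -[x]mulmx1 -Mb0 -thE thx !mxE.
pose G (j : 'I_n) (q : 'I_d.+1) : 'M[K]_(s, d) := (th^-1)%VF (delta_mx j q).
pose phi j l i := Lam (delta_mx l i) 0 j.
pose psi j q l i := th (delta_mx l i) j q.
have GE l r l' i : \sum_j \sum_q psi j q l r * G j q l' i = ((l == l') && (r == i))%:R.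
  transitivity ((delta_mx l r : 'M[K]_(s, d)) l' i); last first.
    by rewrite mxE eq_sym (eq_sym i).
  rewrite -[in RHS](lker0_lfunK th_inj (delta_mx l r)).
  rewrite [in RHS](matrix_sum_delta (th _)).
  rewrite linear_sum summxE; apply: eq_bigr => j _; rewrite linear_sum summxE.
  by apply: eq_bigr => q _; rewrite linearZ mxE.
have psiE j q l i : psi j q l i = \sum_r Mb q i r * phi j l r.
  rewrite /psi thE [X in Lam X]matrix_sum_delta linear_sum summxE (bigD1 l)//=.
  rewrite [X in _ + X]big1 ?addr0 => [|l' /negPf l'l]; last first.
    rewrite linear_sum summxE big1// => r _; rewrite linearZ mxE.
    by rewrite mxE big1 ?mul0r// => p _; rewrite mxE l'l mul0r.
  rewrite linear_sum summxE; apply: eq_bigr => r _; rewrite linearZ mxE.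
  congr (_ * _); rewrite mxE (bigD1 i)//= mxE !eqxx mul1r big1 ?addr0// => p /negPf pi.
  by rewrite mxE pi andbF mul0r.
(* [Phi] is the matrix of F tensored with A (x) Q. The target indices (l, p) are
   listed as (p, l), so that source and target are indexed by the same type. *)
pose Phi (ju : 'I_n * 'I_s) (pl : 'I_n * 'I_s) : A :=
  \sum_i phi ju.1 pl.2 i *: N i ju.2 pl.1.
pose Psi (pl : 'I_n * 'I_s) (ju : 'I_n * 'I_s) : A :=
  \sum_i \sum_q G ju.1 q pl.2 i *: \sum_u Y pl.1 i u * Rb q u ju.2.
have RbPhi q u j pl :
    \sum_u' Rb q u u' * Phi (j, u') pl = \sum_r psi j q pl.2 r *: N r u pl.1.
  under eq_bigr do rewrite mulr_sumr.
  rewrite exchange_big /=.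
  under eq_bigr => i _.
    under eq_bigr do rewrite -scalerAr.
    rewrite -scaler_sumr RbN; over.
  rewrite coef_sum; apply: eq_bigr => r _; rewrite psiE; congr (_ *: _).
  by apply: eq_bigr => i _; rewrite mulrC.
have PsiPhi a b : \sum_ju Psi a ju * Phi ju b = (a == b)%:R.
  case: a b => p' l' [p l].
  rewrite -(pair_bigA _ (fun j u => Psi (p', l') (j, u) * Phi (j, u) (p, l))) /=.
  transitivity (\sum_i \sum_u Y p' i u * \sum_r ((l == l') && (r == i))%:R *: N r u p).
    transitivity (\sum_j \sum_i \sum_q \sum_u \sum_r
        Y p' i u * ((psi j q l r * G j q l' i) *: N r u p)).
      apply: eq_bigr => j _.
      under eq_bigr do rewrite mulr_suml.
      rewrite exchange_big; apply: eq_bigr => i _ /=.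
      under eq_bigr do rewrite mulr_suml.
      rewrite exchange_big; apply: eq_bigr => q _ /=.
      under eq_bigr do rewrite -scalerAl mulr_suml.
      rewrite -scaler_sumr exchange_big scaler_sumr; apply: eq_bigr => u _ /=.
      under eq_bigr do rewrite -mulrA.
      rewrite -mulr_sumr RbPhi /= scalerAr scaler_sumr mulr_sumr.
      by apply: eq_bigr => r _; rewrite scalerA mulrC.
    rewrite exchange_big; apply: eq_bigr => i _ /=.
    under eq_bigr do rewrite exchange_big.
    rewrite exchange_big; apply: eq_bigr => u _ /=.
    under eq_bigr do rewrite exchange_big.
    rewrite exchange_big mulr_sumr; apply: eq_bigr => r _ /=.
    rewrite -GE scaler_suml mulr_sumr; apply: eq_bigr => j _.
    by rewrite scaler_suml mulr_sumr.
  have [->|ll'] := eqVneq l l'; last first.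
    rewrite big1 => [|i _].
      by rewrite xpair_eqE eq_sym (eq_sym l') (negPf ll') andbF.
    by rewrite big1// => u _; rewrite big1 ?mulr0// => r _; rewrite scale0r.
  under eq_bigr do under eq_bigr do
    (under eq_bigr do rewrite eq_sym; rewrite sum_delta).
  by rewrite YN xpair_eqE eqxx andbT eq_sym.
have PhiPsi := weakly_finite_index wfA PsiPhi.
(* [chi] is F itself in coordinates. *)
pose chi0 (y : 'M[K]_(n, d.+1)) : 'M[K]_(s, d) :=
  \matrix_(l, r) \sum_j \sum_q y j q * psi j q l r.
have chi_lin : linear chi0.
  move=> a x y; apply/matrixP => l r; rewrite !mxE mulr_sumr -big_split.
  apply: eq_bigr => j _; rewrite mulr_sumr -big_split; apply: eq_bigr => q _ /=.
  by rewrite !mxE mulrDl mulrA.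
pose chi1 : {linear 'M[K]_(n, d.+1) -> 'M[K]_(s, d)} := HB.pack chi0
  (GRing.isLinear.Build _ _ _ _ chi0 chi_lin).
pose chi := linfun chi1.
have chiE y l r : chi y l r = \sum_j \sum_q y j q * psi j q l r by rewrite lfunE /= mxE.
have chi_inj : lker chi = 0%VS.
  apply/eqP; rewrite -subv0; apply/subvP => y; rewrite memv_ker memv0 => /eqP chiy.
  pose X u (ju : 'I_n * 'I_s) : A := \sum_q y ju.1 q *: Rb q u ju.2.
  have XPhi u pl : \sum_ju X u ju * Phi ju pl = 0.
    rewrite -(pair_bigA _ (fun j u' => X u (j, u') * Phi (j, u') pl)) /=.
    transitivity (\sum_j \sum_q y j q *: \sum_r psi j q pl.2 r *: N r u pl.1).
      apply: eq_bigr => j _; under eq_bigr do rewrite mulr_suml.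
      rewrite exchange_big; apply: eq_bigr => q _ /=.
      by under eq_bigr do rewrite -scalerAl; rewrite -scaler_sumr RbPhi.
    under eq_bigr do rewrite coef_sum.
    rewrite exchange_big big1// => r _ /=; rewrite -scaler_suml.
    by rewrite -chiE chiy mxE scale0r.
  have X0 u ju : X u ju = 0.
    transitivity (\sum_a X u a * (a == ju)%:R).
      rewrite (bigD1 ju)//= eqxx mulr1 big1 ?addr0// => a /negPf->.
      by rewrite mulr0.
    under eq_bigr do rewrite -PhiPsi mulr_sumr.
    rewrite exchange_big big1// => b _ /=.
    under eq_bigr do rewrite mulrA.
    by rewrite -mulr_suml XPhi mul0r.
  apply/eqP/matrixP => j q; rewrite mxE.
  have [|y0 yS] := faithful rhomod rho0
      (x0 := y j ord0) (x := fun i => y j (fintype.lift ord0 i)).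
    move=> u u'; rewrite -[RHS](X0 u (j, u')) /X big_ord_recl /= Rb0.
    congr (_ + _); first by case: (u == u'); rewrite ?scale0r ?scaler0.
    by apply: eq_bigr => i _; rewrite RbS.
  by case: (unliftP ord0 q) => [q' ->|->].
have := limg_ker_dim chi fullv; rewrite capfv chi_inj dimv0 dimvf add0n => dim_chi.
have : (n * d.+1 <= s * d)%N.
  have -> : (n * d.+1 = \dim (limg chi))%N by rewrite dim_chi dim_matrix.
  by rewrite (leq_trans (dimvS (subvf _)))// dimvf dim_matrix.
apply/negP; rewrite -ltnNge mulnS -addn1 addnC leq_add ?(leq_trans s_gt0)//.
by rewrite leq_mul2r sU orbT.
Qed.
End Contradiction.

(** * Slices of tensors *)

Section Slices.
Variables (K : comNzRingType) (U V W : lmodType K).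

Definition lslice (mu : {linear U -> K^o}) : {linear tensor U V -> V} :=
  tens_lunit \o tens_map mu idfun.

Definition rslice (nu : {linear V -> K^o}) : {linear tensor U V -> U} :=
  tens_runit \o tens_map idfun nu.

Lemma lsliceE mu u v : lslice mu (u \ox v) = mu u *: v.
Proof. by rewrite /= tens_mapE tens_lunitE. Qed.

Lemma rsliceE nu u v : rslice nu (u \ox v) = nu v *: u.
Proof. by rewrite /= tens_mapE tens_runitE. Qed.

Lemma tens0l (v : V) : (0 : U) \ox v = 0.
Proof. by rewrite linear0l. Qed.

Lemma tens_sumr (I : finType) (u : U) (v : I -> V) :
  u \ox (\sum_i v i) = \sum_i u \ox v i.
Proof. exact: linear_sumr. Qed.

Lemma tens_suml (I : finType) (u : I -> U) (v : V) :
  (\sum_i u i) \ox v = \sum_i u i \ox v.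
Proof. exact: (linear_sumlz (@tens K U V) v). Qed.

Lemma tensZl a (u : U) (v : V) : (a *: u) \ox v = a *: (u \ox v).
Proof. by rewrite linearZl_LR. Qed.

Lemma tensZr a (u : U) (v : V) : u \ox (a *: v) = a *: (u \ox v).
Proof. by rewrite linearZr_LR. Qed.

Lemma tensDl (u u' : U) (v : V) : (u + u') \ox v = u \ox v + u' \ox v.
Proof. by rewrite linearDl. Qed.

Lemma tensDr (u : U) (v v' : V) : u \ox (v + v') = u \ox v + u \ox v'.
Proof. by rewrite linearDr. Qed.
End Slices.

Arguments lslice {K U V} mu.
Arguments rslice {K U V} nu.

Section SliceAssoc.
Variables (K : comNzRingType) (U V W : lmodType K).

Lemma lslice_assoc (mu : {linear U -> K^o}) (y : tensor U V) (w : W) :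
  lslice mu (tens_assoc (y \ox w)) = lslice mu y \ox w.
Proof.
elim/tensor_ind: y => [|u v y IH]; first by rewrite linear0l !linear0 linear0l.
by rewrite tensDl !linearD IH tensDl tens_assocE !lsliceE tensZl.
Qed.

Lemma rslice_assoc (nu : {linear W -> K^o}) (y : tensor U V) (w : W) :
  tens_map idfun (rslice nu) (tens_assoc (y \ox w)) = (nu w : K) *: y.
Proof.
elim/tensor_ind: y => [|u v y IH]; first by rewrite linear0l !linear0.
rewrite linearDl !linearD /= {}IH tens_assocE tens_mapE.
by rewrite [rslice _ _]rsliceE /= tensZr.
Qed.
End SliceAssoc.

Lemma dependent_solve (K : fieldType) (U : lmodType K) d (u : 'I_d.+1 -> U)
    (y : 'I_d.+1 -> K) i0 :
    \sum_i y i *: u i = 0 -> y i0 != 0 ->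
  u i0 = \sum_i - (y (fintype.lift i0 i) / y i0) *: u (fintype.lift i0 i).
Proof.
move=> + y0; rewrite (bigD1_ord i0)//= => /eqP; rewrite addr_eq0 => /eqP yu.
apply: (scalerI y0); rewrite yu -sumrN scaler_sumr; apply: eq_bigr => i _.
by rewrite scalerA mulrN mulrCA divff// mulr1 scaleNr.
Qed.

Lemma drop_dependent_left (K : fieldType) (U V : lmodType K) d
    (u : 'I_d.+1 -> U) (v : 'I_d.+1 -> V) (y : 'I_d.+1 -> K) i0 :
    \sum_i y i *: u i = 0 -> y i0 != 0 ->
  \sum_i u i \ox v i =
  \sum_i u (fintype.lift i0 i) \ox
    (v (fintype.lift i0 i) - (y (fintype.lift i0 i) / y i0) *: v i0).
Proof.
move=> yu y0; rewrite (bigD1_ord i0)//= (dependent_solve yu y0) tens_suml.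
rewrite -big_split; apply: eq_bigr => i _ /=.
by rewrite -!scaleNr tensDr tensZl tensZr addrC.
Qed.

Lemma drop_dependent_right (K : fieldType) (U V : lmodType K) d
    (u : 'I_d.+1 -> U) (v : 'I_d.+1 -> V) (y : 'I_d.+1 -> K) i0 :
    \sum_i y i *: v i = 0 -> y i0 != 0 ->
  \sum_i u i \ox v i =
  \sum_i (u (fintype.lift i0 i) - (y (fintype.lift i0 i) / y i0) *: u i0) \ox
    v (fintype.lift i0 i).
Proof.
move=> yv y0; rewrite (bigD1_ord i0)//= (dependent_solve yv y0) tens_sumr.
rewrite -big_split; apply: eq_bigr => i _ /=.
by rewrite -!scaleNr tensDl tensZl tensZr addrC.
Qed.

(** A decomposition of minimal length: a linear relation among the left or the
    right factors would shorten it. *)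
Lemma tensor_min_decomposition (K : fieldType) (U V : lmodType K) (x : tensor U V) :
  exists d (u : 'I_d -> U) (v : 'I_d -> V),
    [/\ lin_indep u, lin_indep v & x = \sum_i u i \ox v i].
Proof.
pose Q d := `[< exists (u : 'I_d -> U) (v : 'I_d -> V), x = \sum_i u i \ox v i >].
have [|d /asboolP[u [v xE]] dmin] := @ex_minnP Q.
  have [s xE] := tensorE x; exists (size s); apply/asboolP.
  exists (fun i => (tnth (in_tuple s) i).1), (fun i => (tnth (in_tuple s) i).2).
  by rewrite [LHS]xE big_tnth.
have shorter d' : d = d'.+1 -> forall (u' : 'I_d' -> U) (v' : 'I_d' -> V),
    x <> \sum_i u' i \ox v' i.
  move=> dE u' v' xE'; have /dmin : Q d' by apply/asboolP; exists u', v'.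
  by rewrite dE ltnn.
exists d, u, v; split=> // y yu i0; apply/eqP/negPn/negP => y0.
- case: d u v xE y i0 yu y0 shorter {dmin} => [|d] u v xE y i0 yu y0 shorter.
    by have := ltn_ord i0.
  by case: (shorter d erefl _ _ (etrans xE (drop_dependent_left v yu y0))).
- case: d u v xE y i0 yu y0 shorter {dmin} => [|d] u v xE y i0 yu y0 shorter.
    by have := ltn_ord i0.
  by case: (shorter d erefl _ _ (etrans xE (drop_dependent_right u yu y0))).
Qed.

Section TensorScale.
Variables (K : comNzRingType) (A B : algType K).
Implicit Types x y : tensor A B.

Lemma tens_mulZl k x y : (k *: x) * y = k *: (x * y).
Proof. by rewrite -[LHS]/(Defs.lift (tens_mul1 y) (k *: x)) linearZ. Qed.

Lemma tens_mulZr k x y : x * (k *: y) = k *: (x * y).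
Proof. by rewrite -[LHS]/(tens_mul x (k *: y)) linearZ. Qed.
End TensorScale.

(** * Identities in a Hopf algebra *)

Section HopfIdentities.
Variables (K : fieldType) (A : hopfAlgType K).
Implicit Types (x y : A) (mu : {linear A -> K^o}).

Lemma comul_lslice mu (y : tensor A A) :
  comul (lslice mu y) = lslice mu (tens_map idfun comul y).
Proof.
elim/tensor_ind: y => [|a b y IH]; first by rewrite !linear0.
rewrite !linearD; congr (_ + _); last exact: IH.
by rewrite tens_mapE lsliceE [RHS]lsliceE linearZ.
Qed.

Lemma counitl x : lslice counit (comul x) = x. Proof. exact: comul_counitl. Qed.
Lemma counitr x : rslice counit (comul x) = x. Proof. exact: comul_counitr. Qed.

Lemma comul_slice mu x n (a b : 'I_n -> A) : comul x = \sum_i a i \ox b i ->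
  comul (lslice mu (comul x)) = \sum_i lslice mu (comul (a i)) \ox b i.
Proof.
move=> xE; rewrite comul_lslice -comulA xE (linear_sum (tens_map comul idfun)).
rewrite (linear_sum tens_assoc) (linear_sum (lslice mu)); apply: eq_bigr => i _.
by rewrite tens_mapE; exact: lslice_assoc.
Qed.

(** Its linear extension sends a (x) (b (x) c) to S(a) b (x) c, which is the map
    that contracts S(x1) x2 inside x1 (x) x2 (x) x3. *)
Definition antipode_act (a : A) (y : tensor A A) : tensor A A :=
  (antipode a \ox 1) * y.

Lemma antipode_act_bilinear : bilinear_for *:%R *:%R antipode_act.
Proof.
split=> [y k a b|a k y z]; rewrite /antipode_act.
- by rewrite linearP tensDl tensZl mulrDl tens_mulZl.
- by rewrite /= mulrDr tens_mulZr.
Qed.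

HB.instance Definition _ :=
  bilinear_isBilinear.Build K A (tensor A A) (tensor A A) *:%R *:%R
    antipode_act antipode_act_bilinear.

Lemma antipode_act_assoc (z : tensor A A) y :
  Defs.lift antipode_act (tens_assoc (z \ox y)) =
  mul_map (tens_map antipode idfun z) \ox y.
Proof.
elim/tensor_ind: z => [|a b z IH]; first by rewrite tens0l !linear0 tens0l.
rewrite tensDl !linearD tensDl; congr (_ + _); last exact: IH.
rewrite tens_assocE tens_mapE mul_mapE [LHS]lift_tens.
by rewrite [LHS]tensM mul1r.
Qed.

Lemma antipode_act_comul x :
  Defs.lift antipode_act (tens_map idfun comul (comul x)) = 1 \ox x.
Proof.
rewrite -comulA -[in RHS](counitl x).
elim/tensor_ind: (comul x) => [|a b y IH]; first by rewrite !linear0 linear0r.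
rewrite !linearD tensDr; congr (_ + _); last exact: IH.
rewrite tens_mapE lsliceE tensZr -tensZl -antipodel.
exact: antipode_act_assoc.
Qed.

(** In Sweedler notation, the hypothesis gives
    S(x1) x2 P1 (x) x3 P2 = S(x) P1 (x) P2, and S(x1) x2 (x) x3 = 1 (x) x. *)
Lemma lmul_comul x P : comul x * (1 \ox P) = x \ox P ->
  (1 \ox x) * comul P = (antipode x \ox 1) * comul P.
Proof.
move=> xP.
have H (y : tensor A A) :
    Defs.lift antipode_act (tens_map idfun comul (y * (1 \ox P))) =
    Defs.lift antipode_act (tens_map idfun comul y) * comul P.
  elim/tensor_ind: y => [|a b y IH]; first by rewrite mul0r !linear0 mul0r.
  rewrite mulrDl !linearD mulrDl; congr (_ + _); last exact: IH.
  rewrite tensM !tens_mapE [LHS]lift_tens [X in _ = X * _]lift_tens mulr1.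
  by rewrite /= /antipode_act rmorphM mulrA.
by rewrite -antipode_act_comul -H xP tens_mapE [LHS]lift_tens.
Qed.

End HopfIdentities.

Lemma lin_indep_inj (K : fieldType) (V : lmodType K) d (v : 'I_d -> V)
    (x y : 'I_d -> K) :
  lin_indep v -> \sum_i x i *: v i = \sum_i y i *: v i -> x =1 y.
Proof.
move=> vI xy i; apply/eqP; rewrite -subr_eq0; apply/eqP.
apply: (vI (fun i => x i - y i)); under eq_bigr do rewrite scalerBl.
by rewrite sumrB xy subrr.
Qed.

Lemma linear_comb (K : fieldType) (U V : lmodType K) (f : {linear U -> V})
    (I : finType) (a : I -> K) (x : I -> U) :
  f (\sum_i a i *: x i) = \sum_i a i *: f (x i).
Proof. by rewrite linear_sum; apply: eq_bigr => i _; rewrite linearZ. Qed.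

Lemma rslice_lin_comb (K : fieldType) (U V : lmodType K) (nu : {linear V -> K^o})
    (I : finType) (a : I -> K) (x : I -> tensor U V) :
  rslice nu (\sum_i a i *: x i) = \sum_i a i *: rslice nu (x i).
Proof. exact: linear_comb. Qed.

(** * The coideal spanned by the legs of the projection *)

Section Coordinates.
Variables (K : fieldType) (A : hopfAlgType K) (P : A).
Hypothesis hP : right_grouplike_projection P.
Variables (d : nat) (w v : 'I_d -> A).
Hypothesis wI : lin_indep w.
Hypothesis vI : lin_indep v.
Hypothesis comulP : comul P = \sum_i w i \ox v i.
Variables (mu nu : 'I_d -> {linear A -> K^o}).
Hypothesis muw : forall i j, mu i (w j) = (i == j)%:R.
Hypothesis nuv : forall i j, nu i (v j) = (i == j)%:R.

Lemma slice_comulP f : lslice f (comul P) = \sum_i (f (w i) : K) *: v i.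
Proof.
rewrite comulP (linear_sum (lslice f)); apply: eq_bigr => i _.
by rewrite lsliceE.
Qed.

Lemma slice_muE i : lslice (mu i) (comul P) = v i.
Proof. by rewrite slice_comulP; under eq_bigr do rewrite muw; rewrite sum_delta. Qed.

Lemma slice_in_calN f : calN P (lslice f (comul P)).
Proof.
have [_ _ PPr PPl] := hP.
suff [Hr Hl] : comul (lslice f (comul P)) * (1 \ox P) = lslice f (comul P) \ox P /\
    (1 \ox P) * comul (lslice f (comul P)) = lslice f (comul P) \ox P.
  by split; rewrite ?Hr ?Hl.
have mapE : tens_map (lslice f \o comul) idfun (P \ox P) = lslice f (comul P) \ox P.
  by rewrite tens_mapE.
rewrite (comul_slice f comulP) -mapE; split.
- rewrite -PPr comulP !mulr_suml (linear_sum (tens_map _ _)).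
  by apply: eq_bigr => i _; rewrite !tensM !mulr1 tens_mapE.
- rewrite PPl comulP !mulr_sumr (linear_sum (tens_map _ _)).
  by apply: eq_bigr => i _; rewrite !tensM !mul1r tens_mapE.
Qed.

Lemma v_in_calN i : calN P (v i).
Proof. by rewrite -slice_muE; apply: slice_in_calN. Qed.

Lemma calN_absorb x : calN P x -> x * P = (counit x : K) *: P.
Proof.
move=> [xPl xPr]; have H (y : tensor A A) :
    lslice counit (y * (1 \ox P)) = lslice counit y * P.
  elim/tensor_ind: y => [|a b y IH]; first by rewrite mul0r !linear0 mul0r.
  rewrite mulrDl !linearD mulrDl; congr (_ + _); last exact: IH.
  by rewrite tensM mulr1 !lsliceE scalerAl.
by rewrite -{1}[x]counitl -H xPl xPr lsliceE.
Qed.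

Lemma counit_P : counit P = 1 :> K.
Proof.
have [P0 PP _ _] := hP; have := calN_absorb (slice_in_calN counit).
rewrite counitl PP -{1}[P]scale1r => /eqP; rewrite -subr_eq0 -scalerBl scaler_eq0.
by rewrite (negPf P0) orbF subr_eq0 => /eqP.
Qed.

Lemma calN_mul x i : calN P x ->
  x * v i = \sum_r (mu i (antipode x * w r) : K) *: v r.
Proof.
move=> [xPl xPr]; have /(congr1 (lslice (mu i))) := lmul_comul (etrans xPl xPr).
rewrite comulP !mulr_sumr !(linear_sum (lslice (mu i))).
under eq_bigr do rewrite tensM mul1r lsliceE muw.
under [RHS]eq_bigr do rewrite tensM mul1r lsliceE.
by rewrite sum_delta.
Qed.

(* The coaction and the multiplication of the span of v, in coordinates. The
   multiplication is read off [calN_mul], as [v i] lies in [calN P]. *)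
Let c i j : A := lslice (mu i) (comul (w j)).
Let M i : 'M[K]_d := \matrix_(r, j) (mu j (antipode (v i) * w r) : K).

Lemma comul_v i : comul (v i) = \sum_j c i j \ox v j.
Proof. by rewrite -{1}slice_muE (comul_slice _ comulP). Qed.

Lemma rslice_comul_v i j : rslice (nu j) (comul (v i)) = c i j.
Proof.
rewrite comul_v (linear_sum (rslice (nu j))).
under eq_bigr do rewrite rsliceE nuv.
by rewrite sum_delta.
Qed.

Lemma comul_lin_comb n (a : 'I_n -> K) (x : 'I_n -> A) :
  comul (\sum_i a i *: x i) = \sum_i a i *: comul (x i).
Proof. exact: linear_comb. Qed.

Lemma comul_c i j : comul (c i j) = \sum_k c i k \ox c k j.
Proof.
have := comulA (v i).
rewrite (comul_v i) => /(congr1 (tens_map idfun (rslice (nu j)))).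
rewrite (linear_sum (tens_map comul idfun)) (linear_sum tens_assoc).
rewrite (linear_sum (tens_map idfun (rslice (nu j)))).
rewrite (linear_sum (tens_map idfun comul)).
rewrite (linear_sum (tens_map idfun (rslice (nu j)))).
under eq_bigr do rewrite tens_mapE rslice_assoc nuv.
rewrite sum_delta => ->; apply: eq_bigr => k _.
by rewrite !tens_mapE; congr (_ \ox _); exact: rslice_comul_v.
Qed.

Lemma counit_c i j : counit (c i j) = (i == j)%:R :> K.
Proof.
have := counitl (v i); rewrite comul_v (linear_sum (lslice counit)).
under eq_bigr do rewrite lsliceE.
rewrite -[in RHS](sum_delta i v) => /(lin_indep_inj vI) -> //.
Qed.

Lemma antipode_c t r : \sum_i antipode (c t i) * c i r = (t == r)%:R.
Proof.
have := antipodel (c t r); rewrite counit_c comul_c scaler_nat.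
rewrite (linear_sum (tens_map antipode idfun)) (linear_sum mul_map) => <-.
by apply: eq_bigr => i _; rewrite tens_mapE mul_mapE.
Qed.

Lemma v_mul i j : v i * v j = \sum_r M i r j *: v r.
Proof. by rewrite (calN_mul _ (v_in_calN i)); apply: eq_bigr => r _; rewrite mxE. Qed.

Lemma v_module : is_module M M.
Proof.
move=> i j; apply/matrixP => r q.
have : v i * (v j * v q) = v i * v j * v q by rewrite mulrA.
rewrite !v_mul mulr_sumr mulr_suml.
under eq_bigr do rewrite -scalerAr v_mul.
under [RHS]eq_bigr do rewrite -scalerAl v_mul.
rewrite !coef_sum => /(lin_indep_inj vI)/(_ r) e.
rewrite [LHS]mxE summxE; under eq_bigr do rewrite mulrC.
by rewrite [LHS]e; apply: eq_bigr => p _; rewrite [RHS]mxE.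
Qed.

Lemma comulM x y : comul (x * y) = comul x * comul y :> tensor A A.
Proof. exact: rmorphM. Qed.

Lemma nu_v_mul t a b : nu t (v a * v b) = M a t b.
Proof.
rewrite v_mul linear_comb (bigD1 t)//= nuv eqxx [_ *: _]mulr1 big1 ?addr0// => r.
by rewrite nuv eq_sym => /negPf->; rewrite scaler0.
Qed.

Lemma c_mul q i t :
  \sum_a \sum_b M a t b *: (c q a * c i b) = \sum_r M q r i *: c r t.
Proof.
have /(congr1 (rslice (nu t))) : comul (v q) * comul (v i) = comul (v q * v i).
  by rewrite rmorphM.
rewrite v_mul comul_lin_comb rslice_lin_comb.
under [RHS]eq_bigr do rewrite rslice_comul_v.
move=> <-; rewrite !comul_v mulr_suml (linear_sum (rslice (nu t))).
apply: eq_bigr => a _; rewrite mulr_sumr (linear_sum (rslice (nu t))).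
by apply: eq_bigr => b _; rewrite tensM rsliceE nu_v_mul.
Qed.

Let e : 'rV[K]_d := \row_i (counit (v i) : K).

Lemma P_eq : P = \sum_i (counit (w i) : K) *: v i.
Proof. by rewrite -slice_comulP counitl. Qed.

Lemma e_neq0 : e != 0.
Proof.
apply/eqP => e0; have /eqP := counit_P; rewrite P_eq linear_comb big1.
  by rewrite eq_sym oner_eq0.
move=> i _; rewrite [X in _ *: X](_ : _ = 0) ?scaler0//.
by have /rowP/(_ i) := e0; rewrite !mxE.
Qed.

Lemma e_mul j : e *m M j = e 0 j *: e.
Proof.
apply/rowP => i; rewrite !mxE.
have : counit (v j * v i) = counit (v j) * counit (v i) by rewrite rmorphM.
rewrite v_mul linear_comb => <-; apply: eq_bigr => r _.
by rewrite [e _ _]mxE mulrC.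
Qed.

(** P = P P gives Delta(P) = Delta(P) Delta(P), so each [v i] is a combination of
    products [v a * v b], and a functional that kills these products is zero. *)
Lemma M_nondeg (l : 'rV[K]_d) : (forall j, l *m M j = 0) -> l = 0.
Proof.
move=> lM; pose f (x : A) : K := \sum_r l 0 r * nu r x.
have fD (I : finType) (a : I -> K) (x : I -> A) :
    f (\sum_i a i *: x i) = \sum_i a i * f (x i).
  rewrite /f; under eq_bigr do rewrite linear_comb mulr_sumr.
  rewrite exchange_big; apply: eq_bigr => i _; rewrite mulr_sumr.
  by apply: eq_bigr => r _; exact: mulrCA.
have fv j : f (v j) = l 0 j.
  rewrite /f (bigD1 j)//= nuv eqxx mulr1 big1 ?addr0// => r /negPf rj.
  by rewrite nuv rj mulr0.
have fvv j i : f (v j * v i) = 0.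
  rewrite v_mul fD; have /rowP/(_ i) := lM j; rewrite !mxE => lMi.
  by rewrite -[RHS]lMi; apply: eq_bigr => r _; rewrite fv mulrC.
have [_ PP _ _] := hP; apply/rowP => i; rewrite mxE -fv -slice_muE -PP comulM comulP.
rewrite mulr_suml (linear_sum (lslice (mu i))).
under eq_bigr => a _.
  rewrite mulr_sumr (linear_sum (lslice (mu i))).
  under eq_bigr => b _ do rewrite tensM lsliceE.
  over.
rewrite pair_bigA /=.
rewrite (fD _ (fun p => mu i (w p.1 * w p.2) : K) (fun p => v p.1 * v p.2)) big1//.
by move=> p _; rewrite fvv mulr0.
Qed.

Hypothesis v1 : forall z : 'I_d -> K, \sum_i z i *: v i <> 1.

Lemma v1_indep x0 (x : 'I_d -> K) : x0 *: 1 + \sum_i x i *: v i = 0 ->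
  x0 = 0 /\ forall i, x i = 0.
Proof.
move=> x0x; have x00 : x0 = 0.
  apply/eqP/negPn/negP => x0n; apply: (v1 (z := fun i => - x0^-1 * x i)).
  under eq_bigr do rewrite -scalerA; rewrite -scaler_sumr.
  move/eqP: x0x; rewrite addrC addr_eq0 => /eqP->.
  by rewrite scalerN scaleNr opprK scalerA mulVf// scale1r.
by split=> //; apply: vI; rewrite -[RHS]x0x x00 scale0r add0r.
Qed.

(** Let b act as zero on A (x) Q, where Q is the module given by rho. Then so does
    b P = eps(b) P. But P acts by [\sum_j w j rho_j], which is nonzero because the
    [w j] are independent; hence eps(b) = 0. The kernel of the action is a left
    coideal, so eps also vanishes on every slice f(b1) b2; as
    eps(f(b1) b2) = f(b), every functional f kills b, and b = 0. *)
Lemma coaction_faithful s (rho : 'I_d -> 'M[K]_s) : is_module M rho ->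
  (exists j, rho j != 0) -> forall x0 (x : 'I_d -> K),
  (forall p q : 'I_s,
     (x0 *+ (p == q)) *: 1 + \sum_i x i *: \sum_j rho j p q *: c i j = 0) ->
  x0 = 0 /\ forall i, x i = 0.
Proof.
move=> rhomod [j0 rho0].
pose R i p q : A := \sum_j rho j p q *: c i j.
have RR a i p q : \sum_u R a p u * R i u q = \sum_r M a r i *: R r p q.
  transitivity (\sum_b \sum_t (\sum_u rho b p u * rho t u q) *: (c a b * c i t)).
    under eq_bigr do rewrite mul_lin_comb.
    rewrite exchange_big; apply: eq_bigr => b _ /=; rewrite exchange_big /=.
    by apply: eq_bigr => t _; rewrite scaler_suml.
  under eq_bigr => b _.
    under eq_bigr => t _.
      have -> : \sum_u rho b p u * rho t u q = \sum_r rho r p q * M b r t.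
        have /matrixP/(_ p q) := rhomod b t; rewrite mxE => ->.
        by rewrite summxE; apply: eq_bigr => r _; rewrite mxE mulrC.
      over.
    rewrite -coef_sum; over.
  rewrite /= exchange_big /=; under eq_bigr do rewrite -scaler_sumr c_mul scaler_sumr.
  rewrite exchange_big; apply: eq_bigr => r _; rewrite /= scaler_sumr.
  by apply: eq_bigr => t _; rewrite !scalerA mulrC.
pose pw i : K := counit (w i).
have Rw p q : \sum_i pw i *: R i p q = \sum_j rho j p q *: w j.
  under eq_bigr do rewrite scaler_sumr.
  rewrite exchange_big; apply: eq_bigr => j _ /=.
  under eq_bigr do rewrite scalerA mulrC -scalerA.
  rewrite -scaler_sumr; congr (_ *: _).
  have /(congr1 (rslice (nu j))) : comul P = \sum_i pw i *: comul (v i).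
    by rewrite [in LHS]P_eq comul_lin_comb.
  rewrite comulP (linear_sum (rslice (nu j))) rslice_lin_comb.
  under eq_bigr do rewrite rsliceE nuv.
  by rewrite sum_delta => ->; apply: eq_bigr => i _; rewrite rslice_comul_v.
have vP a r : \sum_i pw i * M a r i = counit (v a) * pw r.
  have : v a * P = (counit (v a) : K) *: P by apply/calN_absorb/v_in_calN.
  rewrite {1}P_eq mulr_sumr; under eq_bigr do rewrite -scalerAr v_mul.
  rewrite coef_sum P_eq scaler_sumr; under [RHS]eq_bigr do rewrite scalerA.
  by move/(lin_indep_inj vI).
have counit0 x0 (x : 'I_d -> K) :
    (forall p q, (x0 *+ (p == q)) *: 1 + \sum_i x i *: R i p q = 0) ->
    x0 + \sum_i x i * counit (v i) = 0.
  move=> xR; have RP p q :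
      (x0 + \sum_i x i * counit (v i)) *: (\sum_j rho j p q *: w j) = 0.
    rewrite -Rw.
    transitivity (\sum_u ((x0 *+ (p == u)) *: 1 + \sum_i x i *: R i p u) *
                     (\sum_i pw i *: R i u q)); last first.
      by rewrite big1// => u _; rewrite xR mul0r.
    under [RHS]eq_bigr do rewrite mulrDl.
    rewrite big_split /= scalerDl; congr (_ + _).
      rewrite [RHS](bigD1 p)//= eqxx -scalerAl mul1r [X in _ + X]big1 ?addr0// => u.
      by rewrite eq_sym => /negPf->; rewrite scale0r mul0r.
    under [RHS]eq_bigr do rewrite mul_lin_comb.
    rewrite exchange_big scaler_suml; apply: eq_bigr => a _ /=.
    rewrite exchange_big /=; under [RHS]eq_bigr do rewrite -scaler_sumr RR -scalerA.
    by rewrite -scaler_sumr coef_sum -scalerA scaler_sumr;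
       under [in RHS]eq_bigr do rewrite vP -scalerA.
  have [p [q rho_pq]] : exists p q, rho j0 p q != 0.
    apply/not_existsP => r0; move/eqP: rho0; apply; apply/matrixP => p q.
    by rewrite mxE; apply/eqP/negPn/negP => npq; apply: (r0 p); exists q.
  have := RP p q; rewrite scaler_sumr; under eq_bigr do rewrite scalerA.
  by move/wI/(_ j0)/eqP; rewrite mulf_eq0 (negPf rho_pq) orbF => /eqP.
move=> x0 x xR; apply: v1_indep; apply: functional_separates => f.
have := counit0 (x0 * f 1) (fun k => \sum_i x i * f (c i k)).
have -> : f (x0 *: 1 + \sum_i x i *: v i) =
    x0 * f 1 + \sum_k (\sum_i x i * f (c i k)) * counit (v k).
  have fv i : f (v i) = \sum_k counit (v k) * f (c i k) :> K.
    rewrite -{1}[v i]counitr comul_v (linear_sum (rslice counit)).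
    by under eq_bigr do rewrite rsliceE; rewrite linear_comb.
  rewrite linearD linearZ linear_comb; congr (_ + _).
  under [RHS]eq_bigr do rewrite mulr_suml.
  rewrite exchange_big; apply: eq_bigr => i _; rewrite fv [LHS]mulr_sumr.
  by apply: eq_bigr => k _; rewrite mulrCA mulrC.
apply=> p q; pose D : {linear A -> A} := lslice f \o comul.
have D1 : D 1 = (f 1 : K) *: 1.
  by rewrite /D /= (_ : comul 1 = 1 \ox 1) ?[LHS]lsliceE//; apply: rmorph1.
have Dc i j : D (c i j) = \sum_k (f (c i k) : K) *: c k j.
  rewrite -[LHS]/(lslice f (comul (c i j))) comul_c (linear_sum (lslice f)).
  by apply: eq_bigr => k _; rewrite lsliceE.
have /(congr1 D) := xR p q; rewrite linear0 linearD linearZ => xR0.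
rewrite -[RHS]xR0; congr (_ + _).
  by rewrite [in RHS]D1 /= scalerA -mulrnAl.
rewrite linear_comb -coef_sum; apply: eq_bigr => i _; congr (_ *: _).
rewrite linear_comb; under [RHS]eq_bigr do rewrite Dc scaler_sumr.
rewrite [RHS]exchange_big; apply: eq_bigr => k _ /=; rewrite scaler_sumr.
by apply: eq_bigr => j _; rewrite !scalerA mulrC.
Qed.

Lemma span_without_unit_absurd : weakly_finite A -> False.
Proof.
move=> wfA; exact: (@matrix_coefficients_absurd K A d M c
  (fun i j => antipode (c i j)) e wfA v_module antipode_c c_mul e_neq0 e_mul
  M_nondeg coaction_faithful).
Qed.

End Coordinates.

(** * The theorem *)

Theorem corollary3p20 (K : fieldType) (A : hopfAlgType K)
    (hS : bijective (antipode : A -> A)) (hA : weakly_finite A)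
    (P : A) (hP : right_grouplike_projection P) :
  calN P = calV P.
Proof.
have [d [w [v [wI vI comulP]]]] := tensor_min_decomposition (comul P).
have [mu muw] := dual_functionals wI.
have [nu nuv] := dual_functionals vI.
apply/seteqP; split=> x; last by move=> [f _ <-]; apply: (slice_in_calN hP comulP).
move=> Nx; have [z z1] : exists z : 'I_d -> K, \sum_i z i *: v i = 1.
  apply/not_existsP => v1.
  exact: (span_without_unit_absurd hP wI vI comulP muw nuv v1 hA).
have xE : x = \sum_j (\sum_i z i * mu i (antipode x * w j)) *: v j.
  rewrite -[LHS]mulr1 -z1 mulr_sumr -coef_sum; apply: eq_bigr => i _.
  by rewrite -scalerAr (calN_mul comulP muw).
pose f0 (a : A) : K^o :=
  \sum_j (\sum_i z i * mu i (antipode x * w j)) *: (mu j a : K^o).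
have f0_lin : linear f0.
  move=> k a b; rewrite /f0 scaler_sumr -big_split; apply: eq_bigr => j _.
  rewrite linearP scalerDr; congr (_ + _); exact: mulrCA.
pose f : {linear A -> K^o} := HB.pack f0 (GRing.isLinear.Build K A K^o *:%R f0 f0_lin).
exists f => //; rewrite -[tens_lunit _]/(lslice f (comul P)) (slice_comulP comulP).
rewrite [RHS]xE; apply: eq_bigr => j _; congr (_ *: _).
rewrite /f /= /f0 (bigD1 j)//= [X in _ + X]big1 => [|i /negPf ij].
  by rewrite muw eqxx addr0 [LHS]mulr1.
by rewrite muw ij scaler0.
Qed.
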